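(* Let $r\ge1$ and let $\mu$ be a partition of $2r$ in which odd parts occur with even multiplicity. (a) If $\mathfrak{g}=\mathfrak{osp}(1,2r)$ then $k(\mathcal{O}_\mu)=\operatorname{rank}J_\mu$. (b) If $\mathfrak{g}=\mathfrak{osp}(2,2r)$ then $k(\mathcal{O}_\mu)=2\operatorname{rank}J_\mu$.
   Context: All Lie superalgebras are over $\mathbb{C}$. $J_\mu$ is the nilpotent matrix with Jordan blocks of sizes $\mu_1,\mu_2,\ldots$. For $\mathfrak{g}=\mathfrak{osp}(1,2r)$ one has $\mathfrak{g}_0=\mathfrak{sp}(2r)$; for $\mathfrak{g}=\mathfrak{osp}(2,2r)$ one has $\mathfrak{g}_0=\mathfrak{sp}(2r)\oplus\mathbb{C}z$ with $z$ central in $\mathfrak{g}_0$. In both cases the nilpotent orbits in $\mathfrak{g}_0$ (contained in $\mathfrak{sp}(2r)$) are parameterized by the partitions $\mu$ of $2r$ in which odd parts occur with even multiplicity; $\mathcal{O}_\mu$ is the orbit of elements with Jordan type $\mu$ on the natural module $\mathbb{C}^{2r}$. Definition of $k$. For a finite dimensional Lie superalgebra $\mathfrak{g}=\mathfrak{g}_0\oplus\mathfrak{g}_1$ over $\mathbb{C}$ with basis $v_1,\dots,v_N$ of $\mathfrak{g}_1$, let $M(\mathfrak{g})=([v_i,v_j])_{i,j}$, a symmetric matrix with entries in $\mathfrak{g}_0\subset S(\mathfrak{g}_0)$. For a prime ideal $q$ of $S(\mathfrak{g}_0)$, $k(q)$ is the rank of $M(\mathfrak{g})$ modulo $q$, as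 a matrix over the fraction field of $S(\mathfrak{g}_0)/q$. Identify $\mathfrak{g}_0$ with $\mathfrak{g}_0^*$ using a nondegenerate invariant bilinear form on $\mathfrak{g}_0$, so that elements of $S(\mathfrak{g}_0)$ are functions on $\mathfrak{g}_0$. For a nilpotent orbit $\mathcal{O}\subset\mathfrak{g}_0$, $k(\mathcal{O}):=k(q)$, where $q$ is the prime ideal of functions in $S(\mathfrak{g}_0)$ vanishing on $\mathcal{O}$. *)

(* Defs.v *)
From HB Require Import structures.
From mathcomp Require Import all_boot all_order all_algebra.
From mathcomp Require Import ring_quotient fraction.
From mathcomp Require Import ring.
From mathcomp Require Import boolp classical_sets.
From mathcomp.multinomials Require Import mpoly.

Set Implicit Arguments.
Unset Strict Implicit.
Unset Printing Implicit Defensive.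

Import GRing.Theory.

Local Open Scope ring_scope.
Local Open Scope quotient_scope.

(* The library only proves that [{ideal_quot q}] has no zero divisors; building
   its fraction field needs an integral domain structure, hence classically
   chosen inverses. *)
Definition prime_quot (A : comNzRingType) (q : prime_idealr A) : Type :=
  {ideal_quot q}.

Section PrimeQuotient.
Variables (A : comNzRingType) (q : prime_idealr A).

HB.instance Definition _ := GRing.ComNzRing.on (prime_quot q).

Definition prime_quot_unit (x : prime_quot q) : bool :=
  `[< exists y : prime_quot q, y * x == 1 >].

Definition prime_quot_inv (x : prime_quot q) : prime_quot q :=
  if pselect (exists y : prime_quot q, y * x == 1) is left ex then xchoose ex
  else x.

Fact prime_quot_mulV : {in prime_quot_unit, left_inverse 1 prime_quot_inv *%R}.
Proof.
move=> x /asboolP ux; rewrite /prime_quot_inv; case: pselect => [ex|//].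
exact/eqP/(xchooseP ex).
Qed.

Fact prime_quot_unitP (x y : prime_quot q) : y * x = 1 -> prime_quot_unit x.
Proof. by move=> yx1; apply/asboolP; exists y; apply/eqP. Qed.

Fact prime_quot_inv_out : {in [predC prime_quot_unit], prime_quot_inv =1 id}.
Proof.
move=> x /negP nux; rewrite /prime_quot_inv; case: pselect => [ex|//].
by case: nux; apply/asboolP.
Qed.

HB.instance Definition _ := GRing.ComNzRing_hasMulInverse.Build (prime_quot q)
  prime_quot_mulV prime_quot_unitP prime_quot_inv_out.

Fact prime_quot_integral : GRing.integral_domain_axiom (prime_quot q).
Proof. exact: Quotient.rquot_IdomainAxiom. Qed.

HB.instance Definition _ := GRing.ComUnitRing_isIntegral.Build (prime_quot q)
  prime_quot_integral.

Definition residue_frac (f : A) : {fraction (prime_quot q)} :=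
  FracField.tofrac (\pi_{ideal_quot q} f : prime_quot q).

End PrimeQuotient.

(* [br10 v x] is not a field: it is [- br01 x v]. *)
Record lieSuperalgebra (K : fieldType) := LieSuperalgebra {
  even : vectType K;
  odd : vectType K;
  br00 : even -> even -> even;
  br01 : even -> odd -> odd;
  br11 : odd -> odd -> even;
  br00_linearl : forall y, linear (br00^~ y);
  br00_linearr : forall x, linear (br00 x);
  br01_linearl : forall v, linear (br01^~ v);
  br01_linearr : forall x, linear (br01 x);
  br11_linearl : forall w, linear (br11^~ w);
  br11_linearr : forall v, linear (br11 v);
  br00_alt : forall x, br00 x x = 0;
  br11_sym : forall v w, br11 v w = br11 w v;
  jacobi000 : forall x y z,
    br00 x (br00 y z) = br00 (br00 x y) z + br00 y (br00 x z);
  jacobi001 : forall x y v,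
    br01 x (br01 y v) = br01 (br00 x y) v + br01 y (br01 x v);
  jacobi011 : forall x v w,
    br00 x (br11 v w) = br11 (br01 x v) w + br11 v (br01 x w);
  jacobi111 : forall u v w,
    br01 (br11 u v) w + br01 (br11 v w) u + br01 (br11 w u) v = 0
}.

Section KInvariant.
Variables (K : fieldType) (g : lieSuperalgebra K).

(* Symmetric algebra of the even part: polynomials in the vectors of a basis. *)
Local Notation even_sym := {mpoly K[\dim {: even g}]}.

Definition even_to_sym (x : even g) : even_sym :=
  \sum_(i < \dim {: even g}) coord (vbasis {: even g}) i x *: 'X_i.

Definition odd_bracket_mx : 'M[even_sym]_(\dim {: odd g}) :=
  \matrix_(i, j)
    even_to_sym (br11 (vbasis {: odd g})`_i (vbasis {: odd g})`_j).

Definition k_ideal (q : prime_idealr even_sym) : nat :=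
  \rank (map_mx (residue_frac q) odd_bracket_mx).

Definition nondegenerate_invariant_form (B : even g -> even g -> K) : Prop :=
  [/\ forall y, scalar (B^~ y), forall x, scalar (B x),
      forall x y z, B (br00 x y) z = B x (br00 y z)
    & forall x, (forall y, B x y = 0) -> x = 0].

(* [f] as a function on the even part, through [x |-> B x]. *)
Definition sym_eval (B : even g -> even g -> K) (f : even_sym) (x : even g) : K :=
  meval (fun i => B x (vbasis {: even g})`_i) f.

(* [k(O) = n]. Mathcomp bundles primality with the ideal, so it is asserted
   that the vanishing ideal of [O] is prime. *)
Definition k_orbit_eq (B : even g -> even g -> K) (O : set (even g)) (n : nat) :
    Prop :=
  exists q : prime_idealr even_sym,
    (forall f : even_sym, f \in q <-> forall x, O x -> sym_eval B f x = 0)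
    /\ k_ideal q = n.

End KInvariant.

Section OrthoSymplectic.
Variables (K : fieldType) (m r : nat).
Local Notation n := (m + (r + r))%N.

Definition symplectic_mx : 'M[K]_(r + r) := block_mx 0 1%:M (- 1%:M) 0.

Definition osp_form : 'M[K]_n := block_mx 1%:M 0 0 symplectic_mx.

Definition parity_mx : 'M[K]_n := block_mx 1%:M 0 0 (- 1%:M).

Definition parity_defect (s : bool) (X : 'M[K]_n) : 'M[K]_n :=
  parity_mx *m X - (-1) ^+ s *: (X *m parity_mx).

(* Matrix of [F(X u, v) + (-1)^(s |u|) F(u, X v)], where [F(u, v) = u^T F v]. *)
Definition form_defect (s : bool) (X : 'M[K]_n) : 'M[K]_n :=
  X^T *m osp_form + (if s then parity_mx else 1%:M) *m osp_form *m X.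

Fact parity_defect_linear s : linear (parity_defect s).
Proof.
move=> a X Y; rewrite /parity_defect mulmxDr mulmxDl -scalemxAr -scalemxAl.
by rewrite scalerBr scalerDr !scalerA [_ * a]mulrC opprD addrACA.
Qed.
HB.instance Definition _ s := GRing.isLinear.Build K 'M[K]_n 'M[K]_n _
  (parity_defect s) (parity_defect_linear s).

Fact form_defect_linear s : linear (form_defect s).
Proof.
move=> a X Y; rewrite /form_defect linearP /= mulmxDl mulmxDr -scalemxAr.
by rewrite -scalemxAl scalerDr addrACA.
Qed.
HB.instance Definition _ s := GRing.isLinear.Build K 'M[K]_n 'M[K]_n _
  (form_defect s) (form_defect_linear s).

Definition osp_part (s : bool) : {vspace 'M[K]_n} :=
  (lker (linfun (parity_defect s)) :&: lker (linfun (form_defect s)))%VS.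

Lemma osp_partP (s : bool) (X : 'M[K]_n) :
  reflect (parity_mx *m X = (-1) ^+ s *: (X *m parity_mx) /\
           X^T *m osp_form
             = - ((if s then parity_mx else 1%:M) *m osp_form *m X))
          (X \in osp_part s).
Proof.
rewrite memv_cap !memv_ker !lfunE /= /parity_defect /form_defect.
rewrite subr_eq0 addr_eq0; apply: (iffP andP).
  by case=> /eqP ? /eqP ?.
by case=> /eqP ? /eqP ?.
Qed.

Definition superbracket (s t : bool) (X Y : 'M[K]_n) : 'M[K]_n :=
  X *m Y - (-1) ^+ (s && t) *: (Y *m X).

Fact superbracket_linearl s t Y : linear (superbracket s t ^~ Y).
Proof.
move=> a X X'; rewrite /superbracket mulmxDl mulmxDr -scalemxAl -scalemxAr.
by rewrite scalerBr scalerDr !scalerA [_ * a]mulrC opprD addrACA.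
Qed.

Fact superbracket_linearr s t X : linear (superbracket s t X).
Proof.
move=> a Y Y'; rewrite /superbracket mulmxDl mulmxDr -scalemxAl -scalemxAr.
by rewrite scalerBr scalerDr !scalerA [_ * a]mulrC opprD addrACA.
Qed.

Lemma parity_mxK : parity_mx *m parity_mx = 1%:M.
Proof.
rewrite /parity_mx mulmx_block !mulmx0 !mul0mx !addr0 !add0r mulNmx mulmxN.
by rewrite !mul1mx opprK -scalar_mx_block.
Qed.

Lemma tr_parity_mx : parity_mx^T = parity_mx.
Proof. by rewrite /parity_mx tr_block_mx linearN /= !trmx1 !trmx0. Qed.

Lemma superbracket_part (s t : bool) (X Y : 'M[K]_n) : X \in osp_part s -> Y \in osp_part t ->
  superbracket s t X Y \in osp_part (s (+) t).
Proof.
move=> /osp_partP[pX fX] /osp_partP[pY fY]; apply/osp_partP.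
have pM u v A B : parity_mx *m A = (-1) ^+ (u : bool) *: (A *m parity_mx) ->
    parity_mx *m B = (-1) ^+ (v : bool) *: (B *m parity_mx) ->
    parity_mx *m (A *m B) = (-1) ^+ (u (+) v) *: (A *m B *m parity_mx).
  move=> pA pB; rewrite mulmxA pA -scalemxAl -!mulmxA pB -scalemxAr scalerA.
  by rewrite signr_addb.
have trP u A : parity_mx *m A = (-1) ^+ (u : bool) *: (A *m parity_mx) ->
    A^T *m parity_mx = (-1) ^+ (u : bool) *: (parity_mx *m A^T).
  move=> /(congr1 trmx); rewrite trmx_mul tr_parity_mx => ->.
  by rewrite linearZ /= trmx_mul tr_parity_mx.
have fM u v A B : parity_mx *m A = (-1) ^+ (u : bool) *: (A *m parity_mx) ->
    parity_mx *m B = (-1) ^+ (v : bool) *: (B *m parity_mx) ->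
    A^T *m osp_form = - ((if u then parity_mx else 1%:M) *m osp_form *m A) ->
    B^T *m osp_form = - ((if v then parity_mx else 1%:M) *m osp_form *m B) ->
    (A *m B)^T *m osp_form = (-1) ^+ (u && v) *:
      ((if u (+) v then parity_mx else 1%:M) *m osp_form *m (B *m A)).
  move=> pA pB fA fB; rewrite trmx_mul -[LHS]mulmxA fA mulmxN !mulmxA.
  case: u pA fA => pA fA; last first.
    by rewrite mulmx1 fB mulNmx opprK expr0 scale1r addFb.
  rewrite (trP _ _ pB) -!scalemxAl -[parity_mx *m B^T *m _]mulmxA fB.
  rewrite mulmxN mulNmx scalerN opprK; congr (_ *: _).
  by case: v {pB fB} => /=; rewrite !mulmxA ?parity_mxK ?mul1mx ?mulmx1.
split; rewrite /superbracket.
  rewrite mulmxBr -scalemxAr (pM _ _ _ _ pX pY) (pM _ _ _ _ pY pX).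
  by rewrite mulmxBl -scalemxAl scalerBr !scalerA mulrC [t (+) s]addbC.
rewrite linearB linearZ /= mulmxBl -scalemxAl.
rewrite (fM _ _ _ _ pX pY fX fY) (fM _ _ _ _ pY pX fY fX).
rewrite scalerA [t && s]andbC -signr_addb addbb expr0 scale1r.
by rewrite mulmxBr -scalemxAr [t (+) s]addbC opprB.
Qed.

Fact ospval_inj s : injective (@vsval K 'M[K]_n (osp_part s)).
Proof. exact: val_inj. Qed.

Fact ospvalD s (x y : subvs_of (osp_part s)) :
  vsval (x + y) = vsval x + vsval y.
Proof. exact: linearD. Qed.

Fact ospval0 s : vsval (0 : subvs_of (osp_part s)) = 0.
Proof. exact: linear0. Qed.

Definition osp_br (s t : bool) (x : subvs_of (osp_part s))
    (y : subvs_of (osp_part t)) :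
    subvs_of (osp_part (s (+) t)) :=
  vsproj (osp_part (s (+) t)) (superbracket s t (vsval x) (vsval y)).

Lemma vsval_osp_br s t (x : subvs_of (osp_part s)) (y : subvs_of (osp_part t)) :
  vsval (osp_br x y) = superbracket s t (vsval x) (vsval y).
Proof. by rewrite vsprojK ?superbracket_part ?subvsP. Qed.

Fact osp_br_linearl s t (y : subvs_of (osp_part t)) :
  linear (fun x : subvs_of (osp_part s) => osp_br x y).
Proof.
move=> a x x'; rewrite /osp_br.
have -> : vsval (a *: x + x') = a *: vsval x + vsval x' by exact: linearP.
by rewrite superbracket_linearl; apply: linearP.
Qed.

Fact osp_br_linearr s t (x : subvs_of (osp_part s)) :
  linear (fun y : subvs_of (osp_part t) => osp_br x y).
Proof.
move=> a y y'; rewrite /osp_br.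
have -> : vsval (a *: y + y') = a *: vsval y + vsval y' by exact: linearP.
by rewrite superbracket_linearr; apply: linearP.
Qed.

Local Notation even_osp := (subvs_of (osp_part false)).
Local Notation odd_osp := (subvs_of (osp_part true)).

Fact osp_br00_alt (x : even_osp) : @osp_br false false x x = 0.
Proof.
apply: (@ospval_inj false); rewrite (vsval_osp_br (s := false) (t := false)).
by rewrite /superbracket scale1r subrr ospval0.
Qed.

Fact osp_br11_sym (v w : odd_osp) :
  @osp_br true true v w = @osp_br true true w v.
Proof.
apply: (@ospval_inj false); rewrite !(vsval_osp_br (s := true) (t := true)).
by rewrite /superbracket /= expr1 !scaleN1r !opprK addrC.
Qed.

Fact superbracket_jacobi s t u X Y Z :
  superbracket s (t (+) u) X (superbracket t u Y Z) =
    superbracket (s (+) t) u (superbracket s t X Y) Z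
    + (-1) ^+ (s && t) *:
        superbracket t (s (+) u) Y (superbracket s u X Z).
Proof.
rewrite /superbracket !mulmxBr !mulmxBl -!scalemxAr -!scalemxAl !mulmxA.
apply/matrixP => i j; rewrite !mxE.
by case: s t u => [] [] []; rewrite /= ?expr1 ?expr0; ring.
Qed.

Fact osp_jacobi000 (x y z : even_osp) :
  @osp_br false false x (@osp_br false false y z) =
    @osp_br false false (@osp_br false false x y) z
    + @osp_br false false y (@osp_br false false x z).
Proof.
apply: (@ospval_inj false); rewrite (@ospvalD false).
rewrite !(vsval_osp_br (s := false) (t := false)).
by rewrite (superbracket_jacobi false false false) scale1r.
Qed.

Fact osp_jacobi001 (x y : even_osp) (v : odd_osp) :
  @osp_br false true x (@osp_br false true y v) =
    @osp_br false true (@osp_br false false x y) v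
    + @osp_br false true y (@osp_br false true x v).
Proof.
apply: (@ospval_inj true); rewrite (@ospvalD true).
rewrite !(vsval_osp_br (s := false) (t := true)).
rewrite (vsval_osp_br (s := false) (t := false)).
by rewrite (superbracket_jacobi false false true) scale1r.
Qed.

Fact osp_jacobi011 (x : even_osp) (v w : odd_osp) :
  @osp_br false false x (@osp_br true true v w) =
    @osp_br true true (@osp_br false true x v) w
    + @osp_br true true v (@osp_br false true x w).
Proof.
apply: (@ospval_inj false); rewrite (@ospvalD false).
rewrite (vsval_osp_br (s := false) (t := false)).
rewrite !(vsval_osp_br (s := true) (t := true)).
rewrite !(vsval_osp_br (s := false) (t := true)).
by rewrite (superbracket_jacobi false true true) scale1r.
Qed.

Fact osp_jacobi111 (u v w : odd_osp) :
  @osp_br false true (@osp_br true true u v) w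
  + @osp_br false true (@osp_br true true v w) u
  + @osp_br false true (@osp_br true true w u) v = 0.
Proof.
apply: (@ospval_inj true); rewrite !(@ospvalD true) (@ospval0 true).
rewrite !(vsval_osp_br (s := false) (t := true)).
rewrite !(vsval_osp_br (s := true) (t := true)) /superbracket /=.
rewrite expr1 !scaleN1r !scale1r !opprK !mulmxDr !mulmxDl !mulmxA.
by apply/matrixP => i j; rewrite !mxE; ring.
Qed.

Definition osp : lieSuperalgebra K :=
  @LieSuperalgebra K even_osp odd_osp
    (@osp_br false false) (@osp_br false true) (@osp_br true true)
    (@osp_br_linearl _ _) (@osp_br_linearr _ _)
    (@osp_br_linearl _ _) (@osp_br_linearr _ _)
    (@osp_br_linearl _ _) (@osp_br_linearr _ _)
    osp_br00_alt osp_br11_sym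
    osp_jacobi000 osp_jacobi001 osp_jacobi011 osp_jacobi111.

End OrthoSymplectic.

Definition is_partition (mu : seq nat) (d : nat) : Prop :=
  [/\ sorted geq mu, 0%N \notin mu & sumn mu = d].

Definition nilpotent_block (K : fieldType) (d : nat) : 'M[K]_d :=
  \matrix_(i, j) (j == i.+1 :> nat)%:R.

Definition jordan_mx (K : fieldType) (mu : seq nat) :
    'M[K]_(\sum_(i < size mu) nth 0%N mu i) :=
  \mxdiag_(i < size mu) nilpotent_block K (nth 0%N mu i).

(* Similarity to [jordan_mx K mu]; the two sizes, equal as numbers, need not be
   convertible, whence the rectangular change of basis. *)
Definition has_jordan_type (K : fieldType) (d : nat) (A : 'M[K]_d)
    (mu : seq nat) : Prop :=
  exists (P : 'M[K]_(d, \sum_(i < size mu) nth 0%N mu i))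
         (Q : 'M[K]_(\sum_(i < size mu) nth 0%N mu i, d)),
    [/\ P *m Q = 1%:M, Q *m P = 1%:M & A = P *m jordan_mx K mu *m Q].

(* Elements of [osp(m, 2r)_0 = so(m) + sp(2r)] that lie in [sp(2r)] and have
   Jordan type [mu] on the natural module of [sp(2r)]. *)
Definition osp_orbit (K : fieldType) (m r : nat) (mu : seq nat) :
    set (even (osp K m r)) :=
  fun x : subvs_of (osp_part K m r false) =>
    ulsubmx (vsval x : 'M[K]_(m + (r + r))) = 0
    /\ has_jordan_type (drsubmx (vsval x : 'M[K]_(m + (r + r)))) mu.

(* Main.v *)
Require Import Defs.
From mathcomp Require Import all_boot all_order all_algebra.
From mathcomp Require Import reals complex.
From HB Require Import structures.
From mathcomp Require Import ring zify.
From mathcomp Require Import ring_quotient fraction.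
From mathcomp Require Import boolp classical_sets.
From mathcomp.multinomials Require Import mpoly.

(* All points of the orbit give the same rank, so the rank over the fraction
   field is the rank at any point, provided the vanishing ideal is prime.

   Primality: by a polynomial square root trick, elements of sp(2r) that are
   similar are conjugate under Sp(2r), and every element of Sp(2r) lies on a
   rational curve through 1; hence two points of the orbit lie on a rational
   curve inside the orbit. The same trick turns any skew form for which the
   Jordan matrix is infinitesimally symplectic into the standard one, which
   gives a point of the orbit.

   Rank: for u, v in the natural module V let S(u,v) = (u v^T + v u^T) J. These
   span sp(2r), and invariance forces B(x, S(u,v)) = c omega(x u, v) with c
   nonzero. The odd part of osp(m,2r) is V^m, and the sp(2r)-component of
   [c, d] is - sum_k S(c_k, d_k), so the form (v,w) |-> B(x,[v,w]) is m copies
   of - c omega(x _, _), of rank m rank(x). *)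

Set Implicit Arguments.
Unset Strict Implicit.
Unset Printing Implicit Defensive.

Import GRing.Theory Num.Theory.

Local Open Scope ring_scope.
Local Open Scope quotient_scope.

(** * Polynomial square roots of invertible matrices *)

Lemma quadratic_root (K : closedFieldType) (a b c : K) :
  a != 0 \/ b != 0 -> exists x, a * x ^+ 2 + b * x + c = 0.
Proof.
move=> ab; have [a0|a0] := eqVneq a 0.
  have b0 : b != 0 by case: ab => //; rewrite a0 eqxx.
  by exists (- c / b); rewrite a0; field.
have [x Hx] := @solve_monicpoly K 2 (fun i => if i == 0%N then - c / a else - b / a) isT.
by exists x; rewrite Hx !big_ord_recl big_ord0 /=; field.
Qed.

(* Interpolation one root at a time: [p + c f] is corrected at the next root
   [a] by solving for [c]. When [f.[a] = 0] the equation is linear in [c], with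
   slope [2 p.[a]], nonzero because [p.[a] ^+ 2 = a]. *)
Lemma sqrtX_mod (K : numClosedFieldType) (s : seq K) : 0 \notin s ->
  exists p : {poly K}, \prod_(a <- s) ('X - a%:P) %| p ^+ 2 - 'X.
Proof.
elim: s => [|a s IHs]; first by exists 0; rewrite big_nil dvd1p.
rewrite in_cons negb_or => /andP[a0 /IHs[p]]; rewrite big_cons.
set f := \prod_(_ <- _) _ => /dvdpP[q Eq].
have [c Hc] : exists c, f.[a] * c ^+ 2 + (2 * p.[a]) * c + q.[a] = 0.
  apply: quadratic_root.
  have [fa0|] := eqVneq f.[a] 0; [right | by left].
  rewrite mulf_neq0 ?pnatr_eq0 //; apply: contraNneq a0 => pa0.
  move/(congr1 (horner^~ a)): Eq; rewrite !hornerE fa0 pa0 mulr0 expr0n /= sub0r.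
  by move/eqP; rewrite oppr_eq0 eq_sym.
exists (p + c%:P * f).
have -> : (p + c%:P * f) ^+ 2 - 'X = (q + (c + c)%:P * p + c%:P ^+ 2 * f) * f.
  transitivity (p ^+ 2 - 'X + ((c + c)%:P * p + c%:P ^+ 2 * f) * f).
    by rewrite polyCD; ring.
  by rewrite Eq; ring.
rewrite dvdp_mul ?dvdpp // dvdp_XsubCl /root !hornerE /= -Hc.
by apply/eqP; ring.
Qed.

(** Since [0] is not an eigenvalue, ['X] has a square root [p] modulo the characteristic polynomial,
    and Cayley-Hamilton makes [s = p(h)] a root of [h]. Being a polynomial in [h], it inherits both
    the commutation and the self-adjointness of [h]. *)
Lemma mx_sqrt (K : numClosedFieldType) n (h : 'M[K]_n) : h \in unitmx ->
  exists s : 'M[K]_n, [/\ s *m s = h,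
    forall C : 'M_n, C *m h = h *m C -> C *m s = s *m C
  & forall C : 'M_n, h^T *m C = C *m h -> s^T *m C = C *m s].
Proof.
case: n h => [|n] h uh; first by exists h; split=> [|C _|C _]; apply/matrixP; case.
have [s Hs] := closed_field_poly_normal (char_poly h).
rewrite (monicP (char_poly_monic h)) scale1r in Hs.
have s0 : 0 \notin s.
  have : ~~ root (char_poly h) 0.
    by rewrite rootE horner_coef0 char_poly_det mulf_neq0 ?signr_eq0 // -unitfE -unitmxE.
  by rewrite Hs root_prod_XsubC.
have [p /dvdpP[q Eq]] := sqrtX_mod s0.
exists (horner_mx h p); split.
- move/(congr1 (horner_mx h)): Eq; rewrite -Hs rmorphM /= Cayley_Hamilton mulr0.
  by rewrite rmorphB /= horner_mx_X rmorphXn /= => /subr0_eq.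
- by move=> C hC; apply: comm_mx_horner.
- move=> C hC; elim/poly_ind: p {Eq} => [|p c IHp].
    by rewrite !rmorph0 trmx0 mul0mx mulmx0.
  have -> : horner_mx h (p * 'X + c%:P) = horner_mx h p *m h + c%:M.
    by rewrite rmorphD rmorphM /= horner_mx_X horner_mx_C.
  have comm : horner_mx h p *m h = h *m horner_mx h p by apply: comm_horner_mx.
  rewrite linearD /= mulmxDl mulmxDr.
  congr (_ + _); last by rewrite tr_scalar_mx scalar_mxC.
  by rewrite {1}comm trmx_mul -mulmxA hC mulmxA IHp -!mulmxA.
Qed.

(** * Skew forms and conjugacy under the symplectic group *)

Section Symplectic.
Variables (K : fieldType) (r : nat).
Local Notation J := (symplectic_mx K r).

Lemma symplectic_mx_tr : J^T = - J.
Proof.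
by rewrite tr_block_mx !trmx0 linearN /= trmx1 opp_block_mx !oppr0 opprK.
Qed.

Lemma symplectic_mxK : J *m J = - 1%:M.
Proof.
rewrite mulmx_block !mulmx0 !mul0mx !mulmx1 !mul1mx !addr0 !add0r.
by rewrite scalar_mx_block opp_block_mx !oppr0.
Qed.

Lemma symplectic_mx_unit : J \in unitmx.
Proof.
have: J *m (- J) = 1%:M by rewrite mulmxN symplectic_mxK opprK.
by case/mulmx1_unit.
Qed.

Lemma sp_mulJtr (x : 'M[K]_(r + r)) : x^T *m J = - (J *m x) -> J *m x^T = - (x *m J).
Proof.
move=> Sx; apply: (can_inj (mulmxK symplectic_mx_unit)).
rewrite -mulmxA Sx mulNmx -mulmxA symplectic_mxK.
by rewrite !mulmxN mulmx1 mulmxA symplectic_mxK mulNmx mul1mx opprK.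
Qed.

End Symplectic.

Section SymplecticConjugacy.
Variables (K : numClosedFieldType) (r : nat).
Local Notation J := (symplectic_mx K r).

(** Since [J^-1 = - J], the matrix [- (J *m w)] is [J^-1 w], the operator that expresses the form
    [w] through [J]. *)
Lemma skew_mx_selfadjoint (w : 'M[K]_(r + r)) : w^T = - w ->
  (- (J *m w))^T *m J = J *m (- (J *m w)).
Proof.
move=> wT; rewrite linearN /= trmx_mul wT symplectic_mx_tr [- w *m _]mulNmx.
rewrite mulmxN opprK mulNmx -mulmxA mulmxN !mulmxA symplectic_mxK.
by rewrite -mulmxA symplectic_mxK !(mulNmx, mulmxN) mulmx1 mul1mx.
Qed.

(** With [h = J^-1 w], the square root [s] of [h] is self-adjoint for [J] like [h] itself, so
    [s^T J s = J s s = J h = w]. *)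
Lemma skew_mx_congruent (w : 'M[K]_(r + r)) : w^T = - w -> w \in unitmx ->
  exists2 s : 'M_(r + r), s \in unitmx & s^T *m J *m s = w.
Proof.
move=> wT uw; have uh : - (J *m w) \in unitmx.
  by rewrite -mulNmx unitmx_mul uw andbT -scaleN1r unitmxZ ?unitrN1 // symplectic_mx_unit.
have [s [ss _ sJ]] := mx_sqrt uh; exists s.
  by move: uh; rewrite -ss unitmx_mul andbb.
rewrite (sJ J); last exact: skew_mx_selfadjoint.
by rewrite -mulmxA ss mulmxN mulmxA symplectic_mxK mulNmx mul1mx opprK.
Qed.

(* With [sigma g = J^-1 g^T J], conjugation by [g] and by [sigma g]^-1 agree on
   [sp]; so [sigma g * g] centralises [x] and [s = g (sigma g * g)^(-1/2)]. *)
Lemma sp_conj (x y g : 'M[K]_(r + r)) : x^T *m J = - (J *m x) -> y^T *m J = - (J *m y) ->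
  g \in unitmx -> g *m x = y *m g ->
  exists2 s : 'M_(r + r), s^T *m J *m s = J & s *m x = y *m s.
Proof.
move=> Sx Sy ug gx; pose h := - (J *m (g^T *m J *m g)).
have hT : h^T *m J = J *m h.
  apply: skew_mx_selfadjoint; rewrite !trmx_mul trmxK symplectic_mx_tr.
  by rewrite mulNmx mulmxN mulmxA.
have uJ := symplectic_mx_unit K r.
have uh : h \in unitmx.
  by rewrite /h -mulNmx !unitmx_mul unitmx_tr ug uJ !andbT -scaleN1r unitmxZ ?unitrN1.
have JxT := sp_mulJtr Sx.
have xh : x *m h = h *m x.
  rewrite /h mulmxN mulNmx; congr (- _); rewrite -!mulmxA gx.
  have -> : J *m (y *m g) = - (y^T *m (J *m g)).
    by rewrite [y^T *m _]mulmxA Sy mulNmx opprK mulmxA.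
  rewrite mulmxN [g^T *m (y^T *m _)]mulmxA -trmx_mul -gx trmx_mul.
  by rewrite mulmxN !mulmxA JxT !mulNmx opprK.
have [t [tt ct tJ]] := mx_sqrt uh.
have ut : t \in unitmx by move: uh; rewrite -tt unitmx_mul andbb.
have {}ct := ct _ xh; exists (g *m invmx t); last first.
  rewrite -mulmxA; have -> : invmx t *m x = x *m invmx t.
    by apply: (can_inj (mulmxK ut)); rewrite mulmxKV // -mulmxA ct mulKmx.
  by rewrite !mulmxA gx.
have JgJ : g^T *m J *m g = J *m h.
  by rewrite /h mulmxN mulmxA symplectic_mxK mulNmx mul1mx opprK.
have -> : (g *m invmx t)^T *m J *m (g *m invmx t) =
    (invmx t)^T *m (g^T *m J *m g) *m invmx t by rewrite trmx_mul !mulmxA.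
rewrite JgJ -tt !mulmxA mulmxK // -[_ *m J *m t]mulmxA -(tJ J hT) mulmxA.
by rewrite trmx_inv mulVmx ?unitmx_tr // mul1mx.
Qed.

End SymplecticConjugacy.

(** * Rational curves in the symplectic group *)

(** Used both over [K] and over [{poly K}]; the middle factor is spelled out because [symplectic_mx]
    lives over a field. *)
Lemma symplectic_block (R : comNzRingType) r (a b c d : 'M[R]_r) :
  (block_mx a b c d)^T *m block_mx 0 1%:M (- 1%:M) 0 *m block_mx a b c d =
  block_mx (a^T *m c - c^T *m a) (a^T *m d - c^T *m b)
           (b^T *m c - d^T *m a) (b^T *m d - d^T *m b).
Proof.
rewrite tr_block_mx !mulmx_block !mulmx0 !mulmxN !mulmx1 !addr0 !add0r.
by congr block_mx; rewrite mulNmx addrC.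
Qed.

(* With [a] reduced to a partial identity [E], symmetry of [E c] makes
   [1 - E], transported back, a valid choice of [B]. *)
Lemma lagrangian_unit (K : fieldType) r (a c : 'M[K]_r) :
    a^T *m c = c^T *m a ->
    (forall v : 'cV_r, a *m v = 0 -> c *m v = 0 -> v = 0) ->
  exists2 B : 'M_r, B^T = B & a + B *m c \in unitmx.
Proof.
move=> ac inj; pose L := col_ebase a; pose U := row_ebase a.
pose E : 'M[K]_r := pid_mx (\rank a); pose F : 'M[K]_r := 1%:M - E.
have uL : L \in unitmx by apply: col_ebase_unit.
have uU : U \in unitmx by apply: row_ebase_unit.
have Ea : a = L *m E *m U by rewrite mulmx_ebase.
have ET : E^T = E by rewrite tr_pid_mx.
have FT : F^T = F by rewrite /F linearB /= trmx1 ET.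
have EE : E *m E = E by rewrite pid_mx_id // rank_leq_row.
have EF : E *m F = 0 by rewrite mulmxBr mulmx1 EE subrr.
have FE : F = 1%:M - E by [].
clearbody L U E F; pose c' := L^T *m c *m invmx U.
have Ec' : E *m c' = c'^T *m E.
  have -> : E *m c' = (invmx U)^T *m (a^T *m c) *m invmx U.
    by rewrite Ea !trmx_mul ET !mulmxA -trmx_mul mulmxV // trmx1 mul1mx.
  by rewrite ac /c' !trmx_mul trmxK {1}Ea -!mulmxA mulmxV // mulmx1.
exists (L *m F *m L^T).
  by rewrite !trmx_mul trmxK FT mulmxA.
have -> : a + L *m F *m L^T *m c = L *m (E + F *m c') *m U.
  by rewrite mulmxDr mulmxDl -Ea /c' !mulmxA mulmxKV.
rewrite !unitmx_mul uL uU andbT /= -unitmx_tr -row_free_unit.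
rewrite -kermx_eq0; apply/eqP/row_matrixP => i; rewrite row0.
set k := row i _; have : k *m (E + F *m c')^T = 0 by apply/sub_kermxP; rewrite row_sub.
move/(congr1 trmx); rewrite trmx_mul trmxK trmx0; set v := k^T => Hv.
(* Multiplying by [E] isolates [E v = 0]. What remains is [F c' v = 0], and [E c' v = c'^T E v = 0]
   upgrades it to [c' v = 0]; so [U^-1 v] is killed by both [a] and [c]. *)
have Ev : E *m v = 0.
  move/(congr1 (mulmx E)): Hv.
  by rewrite mulmx0 mulmxDl mulmxDr !mulmxA EE EF !mul0mx addr0.
have cv : c' *m v = 0.
  have : F *m c' *m v = 0 by move: Hv; rewrite mulmxDl Ev add0r.
  by rewrite FE mulmxBl mul1mx Ec' mulmxBl -[_ *m E *m v]mulmxA Ev mulmx0 subr0.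
have : invmx U *m v = 0.
  apply: inj; first by rewrite Ea -!mulmxA mulKVmx // Ev mulmx0.
  have uLT : L^T \in unitmx by rewrite unitmx_tr.
  by apply: (can_inj (mulKmx uLT)); rewrite mulmx0 -cv /c' !mulmxA.
move/(congr1 (mulmx U)); rewrite mulKVmx // mulmx0 => /(congr1 trmx).
by rewrite /v trmxK trmx0.
Qed.

Section Connected.
Variables (K : fieldType) (r : nat).
Local Notation J := (symplectic_mx K r).
Implicit Types s : 'M[K]_(r + r).
Local Notation "M ^P" := (map_mx polyC M) (at level 2, format "M ^P").

(** A polynomial curve of similitudes of [J] from the identity to a multiple of [s]. The multiplier
    [d] and the scalar [b] absorb cleared denominators; conjugation does not see them. *)
Definition sp_curve s : Prop :=
  exists (S : 'M[{poly K}]_(r + r)) (d : {poly K}) (b : K),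
  [/\ S^T *m J^P *m S = d *: J^P, map_mx (horner_eval 0) S = 1%:M,
      b != 0 & map_mx (horner_eval 1) S = b *: s].

Lemma polyC_symplectic :
  J^P = block_mx 0 1%:M (- 1%:M) 0 :> 'M[{poly K}]_(r + r).
Proof. by rewrite map_block_mx map_mxN map_mx1 !map_mx0. Qed.

Lemma sp_curveM s s' : sp_curve s -> sp_curve s' -> sp_curve (s *m s').
Proof.
move=> [S [d [b [SJ S0 b0 S1]]]] [S' [d' [b' [SJ' S0' b0' S1']]]].
exists (S *m S'), (d * d'), (b * b'); split.
- rewrite trmx_mul -!mulmxA [S^T *m _]mulmxA [_ *m (S *m _)]mulmxA SJ.
  by rewrite -scalemxAl -scalemxAr mulmxA SJ' scalerA.
- by rewrite map_mxM S0 S0' mulmx1.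
- by rewrite mulf_neq0.
- by rewrite map_mxM S1 S1' -scalemxAl -scalemxAr scalerA.
Qed.

Lemma map_horner_X (t : K) (B : 'M[K]_r) :
  map_mx (horner_eval t) ('X *: B^P) = t *: B.
Proof. by apply/matrixP => i j; rewrite !mxE /horner_eval !hornerE. Qed.

Lemma sp_curve_upper (B : 'M[K]_r) : B^T = B -> sp_curve (block_mx 1%:M B 0 1%:M).
Proof.
move=> BT; exists (block_mx 1%:M ('X *: B^P) 0 1%:M), 1, 1; split.
- rewrite polyC_symplectic symplectic_block !trmx1 !trmx0 !mulmx1 !mul0mx !mul1mx !mulmx0.
  rewrite !subr0 !sub0r scale1r linearZ /= map_trmx BT.
  by rewrite subrr.
- by rewrite map_block_mx map_horner_X scale0r !map_mx1 !map_mx0 -scalar_mx_block.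
- exact: oner_neq0.
- by rewrite map_block_mx map_horner_X !scale1r !map_mx1 !map_mx0.
Qed.

Lemma sp_curve_lower (B : 'M[K]_r) : B^T = B -> sp_curve (block_mx 1%:M 0 B 1%:M).
Proof.
move=> BT; exists (block_mx 1%:M 0 ('X *: B^P) 1%:M), 1, 1; split.
- rewrite polyC_symplectic symplectic_block !trmx1 !trmx0 !mulmx1 !mul0mx !mul1mx !mulmx0.
  rewrite !subr0 !sub0r scale1r linearZ /= map_trmx BT.
  by rewrite subrr.
- by rewrite map_block_mx map_horner_X scale0r !map_mx1 !map_mx0 -scalar_mx_block.
- exact: oner_neq0.
- by rewrite map_block_mx map_horner_X !scale1r !map_mx1 !map_mx0.
Qed.

(** The segment [A] joins the identity to [a], but its inverse is not polynomial. Scaling by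
    [D = \det A] turns the inverse transpose into the transposed adjugate, with multiplier [D ^+ 2]
    and end scalar [\det a]. *)
Lemma sp_curve_diag (a : 'M[K]_r) : a \in unitmx ->
  sp_curve (block_mx a 0 0 (invmx a)^T).
Proof.
move=> ua; pose A := 1%:M + 'X *: (a - 1%:M)^P; pose D := \det A.
have A0 : map_mx (horner_eval 0) A = 1%:M.
  by rewrite map_mxD map_mx1 map_horner_X scale0r addr0.
have A1 : map_mx (horner_eval 1) A = a.
  by rewrite map_mxD map_mx1 map_horner_X scale1r addrC subrK.
exists (block_mx (D *: A) 0 0 (\adj A)^T), (D ^+ 2), (\det a); split.
- rewrite polyC_symplectic symplectic_block !trmx0 !mul0mx !mulmx0.
  rewrite !subr0 !sub0r trmxK linearZ /= -scalemxAr mul_adj_mx -scalemxAl -trmx_mul.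
  rewrite mul_adj_mx tr_scalar_mx !scale_scalar_mx -expr2 scale_block_mx !scaler0.
  by rewrite scalerN scale_scalar_mx mulr1.
- rewrite map_block_mx !map_mx0 map_mxZ A0 -map_trmx map_mx_adj A0.
  by rewrite adj1 /D -det_map_mx A0 det1 scale1r trmx1 -scalar_mx_block.
- by rewrite -unitfE -unitmxE.
- rewrite map_block_mx !map_mx0 map_mxZ A1 -map_trmx map_mx_adj A1.
  rewrite /D -det_map_mx A1 scale_block_mx !scaler0; congr block_mx.
  by rewrite /invmx ua linearZ /= scalerA divff ?scale1r // -unitfE -unitmxE.
Qed.

(** Block factorisation into lower unipotent, diagonal and upper unipotent. The symplectic relations
    make [c a^-1] and [a^-1 b] symmetric and determine [d]. *)
Lemma sp_curve_unit_block (a b c d : 'M[K]_r) : a \in unitmx ->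
  let s := block_mx a b c d in s^T *m J *m s = J -> sp_curve s.
Proof.
move=> ua s; rewrite symplectic_block => /eq_block_mx[/subr0_eq ac ad _ /subr0_eq bd].
have uaT : a^T \in unitmx by rewrite unitmx_tr.
have caT : (c *m invmx a)^T = c *m invmx a.
  rewrite trmx_mul trmx_inv; apply: (can_inj (mulKmx uaT)).
  by rewrite mulKVmx // mulmxA ac mulmxK.
have Ed : d = (invmx a)^T + c *m invmx a *m b.
  apply: (can_inj (mulKmx uaT)); move/eqP: ad; rewrite subr_eq => /eqP ->.
  rewrite mulmxDr -trmx_mul mulVmx // trmx1 -{1}caT trmx_mul trmx_inv.
  by rewrite mulmxA mulKVmx.
have abT : (invmx a *m b)^T = invmx a *m b.
  move: bd; rewrite Ed mulmxDr linearD /= mulmxDl trmxK -trmx_mul.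
  by rewrite [(c *m _ *m b)^T]trmx_mul caT !mulmxA => /addIr.
have -> : s = block_mx 1%:M 0 (c *m invmx a) 1%:M *m
    (block_mx a 0 0 (invmx a)^T *m block_mx 1%:M (invmx a *m b) 0 1%:M).
  rewrite !mulmx_block !(mulmx0, mul0mx, mulmx1, mul1mx, addr0, add0r) mulKVmx //.
  by rewrite mulmxKV // addrC -Ed.
apply: sp_curveM; first exact: sp_curve_lower.
by apply: sp_curveM; [apply: sp_curve_diag | apply: sp_curve_upper].
Qed.

Lemma sp_upper (B : 'M[K]_r) : B^T = B ->
  let u := block_mx 1%:M B 0 1%:M in u^T *m J *m u = J.
Proof.
move=> BT u; rewrite symplectic_block BT !trmx1 !trmx0.
by rewrite !(mulmx0, mul0mx, mulmx1, mul1mx) !subr0 sub0r subrr.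
Qed.

(** The first block column of [s] is injective and isotropic, so [lagrangian_unit] gives an upper
    unipotent factor that makes the upper left block invertible; undoing that factor costs one more
    curve. *)
Lemma sp_curve_sp s : s^T *m J *m s = J -> sp_curve s.
Proof.
rewrite -(submxK s); set a := ulsubmx s; set b := ursubmx s.
set c := dlsubmx s; set d := drsubmx s => sJ.
have := sJ; rewrite symplectic_block => /eq_block_mx[/subr0_eq ac _ _ _].
have inj v : a *m v = 0 -> c *m v = 0 -> v = 0 :> 'cV_r.
  move=> av cv; have sv : block_mx a b c d *m col_mx v 0 = 0.
    by rewrite mul_block_col av cv !mulmx0 !addr0 col_mx0.
  have : J *m col_mx v 0 = 0 by rewrite -sJ -mulmxA sv mulmx0.
  rewrite mul_block_col !mul0mx !mulmx0 !addr0 mulNmx mul1mx.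
  by rewrite -col_mx0 => /eq_col_mx[_ /eqP]; rewrite oppr_eq0 => /eqP.
have [B BT uB] := lagrangian_unit ac inj.
have -> : block_mx a b c d = block_mx 1%:M (- B) 0 1%:M *m
    block_mx (a + B *m c) (b + B *m d) c d.
  by rewrite mulmx_block !(mul0mx, mul1mx, add0r) !mulNmx !addrK.
apply: sp_curveM; first by apply: sp_curve_upper; rewrite linearN /= BT.
apply: sp_curve_unit_block => //.
have -> : block_mx (a + B *m c) (b + B *m d) c d =
    block_mx 1%:M B 0 1%:M *m block_mx a b c d.
  by rewrite mulmx_block !(mul0mx, mul1mx, add0r).
set u := block_mx _ B _ _; rewrite -[RHS]sJ -{2}(sp_upper BT) -/u trmx_mul.
by rewrite !mulmxA.
Qed.

End Connected.

(** * Minors and reduction modulo a prime ideal *)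

Lemma mxrank_mxsub (F : fieldType) m n m' n' (f : 'I_m' -> 'I_m)
  (g : 'I_n' -> 'I_n) (A : 'M[F]_(m, n)) : (\rank (mxsub f g A) <= \rank A)%N.
Proof.
have -> : mxsub f g A = rowsub f (rowsub g A^T)^T.
  by apply/matrixP => i j; rewrite !mxE.
apply: leq_trans (mxrankS (rowsub_sub _ _)) _; rewrite mxrank_tr -(mxrank_tr A).
exact: mxrankS (rowsub_sub _ _).
Qed.

Lemma mxrank_minor (F : fieldType) m n (A : 'M[F]_(m, n)) :
  exists (f : 'I_(\rank A) -> 'I_m) (g : 'I_(\rank A) -> 'I_n),
    \det (mxsub f g A) != 0.
Proof.
pose f := maxrankfun A; pose B := (rowsub f A)^T.
have fullB : row_full B by rewrite /row_full mxrank_tr; have := maxrowsub_free A.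
exists f, (fullrankfun fullB).
have -> : mxsub f (fullrankfun fullB) A = (rowsub (fullrankfun fullB) B)^T.
  by apply/matrixP => i j; rewrite !mxE.
by rewrite det_tr -unitfE -unitmxE fullrowsub_unit.
Qed.

Lemma exists_nonroot (K : numDomainType) (p : {poly K}) :
  p != 0 -> exists t, p.[t] != 0.
Proof.
move=> p0; apply: contrapT => /forallNP Np.
(* These are [size p] distinct integers, one more than the degree allows as roots. *)
pose s : seq K := [seq i%:R | i <- iota 0 (size p)].
suff: (size s < size p)%N by rewrite size_map size_iota ltnn.
apply: max_poly_roots => //.
  by apply/allP => t _; apply/rootP/eqP; move: (Np t) => /negP; rewrite negbK.
by rewrite map_inj_uniq ?iota_uniq // => i j /eqP; rewrite eqr_nat => /eqP.
Qed.

Section ResidueFrac.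
Variables (A : comNzRingType) (q : prime_idealr A).

Fact residue_frac_is_zmod_morphism : zmod_morphism (@residue_frac A q).
Proof. by move=> x y; rewrite /residue_frac -tofracB [in LHS]rmorphB. Qed.
Fact residue_frac_is_monoid_morphism : monoid_morphism (@residue_frac A q).
Proof.
by split=> [|x y]; rewrite /residue_frac ?rmorph1 // -tofracM [in LHS]rmorphM.
Qed.
HB.instance Definition _ := GRing.isZmodMorphism.Build A {fraction (prime_quot q)}
  (@residue_frac A q) residue_frac_is_zmod_morphism.
HB.instance Definition _ := GRing.isMonoidMorphism.Build A {fraction (prime_quot q)}
  (@residue_frac A q) residue_frac_is_monoid_morphism.

Lemma residue_frac_eq0 (f : A) : (residue_frac q f == 0) = (f \in q).
Proof.
rewrite /residue_frac tofrac_eq0.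
rewrite -[in RHS](subr0 f) Quotient.idealrBE [in RHS]rmorph0.
by [].
Qed.
End ResidueFrac.

(** * Vanishing ideals: generic rank and primality *)

Section Vanishing.
Variables (K : numFieldType) (N : nat) (T : Type) (p : T -> 'I_N -> K).
Variable O : set T.

(** Rank is detected by minors. A minor nonzero modulo [q] is nonzero at some point of [O], and a
    minor nonzero at [x0] is not in [q]; since the rank is the same at all points, the two bounds
    meet. *)
Lemma mxrank_residue (q : prime_idealr {mpoly K[N]}) m n
    (M : 'M[{mpoly K[N]}]_(m, n)) k :
    (forall f, f \in q <-> forall x, O x -> meval (p x) f = 0) ->
    (exists x, O x) ->
    (forall x, O x -> \rank (map_mx (meval (p x)) M) = k) ->
  \rank (map_mx (residue_frac q) M) = k.
Proof.
move=> qP [x0 Ox0] rk; apply/anti_leq/andP; split.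
  have [f [g]] := mxrank_minor (map_mx (residue_frac q) M).
  rewrite -map_mxsub det_map_mx residue_frac_eq0 => nq.
  have [x Ox /eqP dx] : exists2 x, O x & meval (p x) (\det (mxsub f g M)) <> 0.
    apply: contrapT => Nx; move/negP: nq; apply; apply/qP => x Ox.
    by apply: contrapT => ?; apply: Nx; exists x.
  rewrite -(rk x Ox); apply: leq_trans (mxrank_mxsub f g _).
  rewrite -map_mxsub mxrank_unit // unitmxE unitfE det_map_mx; exact: dx.
have [f [g]] := mxrank_minor (map_mx (meval (p x0)) M).
rewrite -map_mxsub det_map_mx => dx; rewrite -{1}(rk x0 Ox0).
apply: leq_trans (mxrank_mxsub f g _).
rewrite -map_mxsub mxrank_unit // unitmxE unitfE det_map_mx residue_frac_eq0.
by apply/negP => /qP/(_ _ Ox0)/eqP; apply/negP.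
Qed.

(** Clearing denominators: along the curve [v / d], the function [f] becomes [F / d ^+ D]. Such
    functions are stable under sums and products, so constants and variables suffice. *)
Lemma meval_curve (f : {mpoly K[N]}) (v : 'I_N -> {poly K}) (d : {poly K}) :
  exists (F : {poly K}) (D : nat), forall t, d.[t] != 0 ->
    F.[t] = d.[t] ^+ D * meval (fun i => (v i).[t] / d.[t]) f.
Proof.
pose P (f : {mpoly K[N]}) := exists (F : {poly K}) (D : nat), forall t, d.[t] != 0 ->
    F.[t] = d.[t] ^+ D * meval (fun i => (v i).[t] / d.[t]) f.
have PC c : P c%:MP by exists c%:P, 0%N => t _; rewrite mevalC hornerC mul1r.
have PD g h : P g -> P h -> P (g + h).
  move=> [G [D GE]] [H [E HE]]; exists (G * d ^+ E + H * d ^+ D), (D + E)%N => t dt.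
  by rewrite mevalD !(hornerD, hornerM, horner_exp) (GE _ dt) (HE _ dt) exprD; ring.
have PM g h : P g -> P h -> P (g * h).
  move=> [G [D GE]] [H [E HE]]; exists (G * H), (D + E)%N => t dt.
  by rewrite mevalM !(hornerD, hornerM, horner_exp) (GE _ dt) (HE _ dt) exprD; ring.
have PX i : P 'X_i.
  by exists (v i), 1%N => t dt; rewrite mevalXU expr1 mulrC divfK.
have P1 : P 1 by rewrite -mpolyC1.
have PXn i k : P ('X_i ^+ k).
  by elim: k => [|k IHk]; rewrite ?expr0 // exprS; apply: PM.
rewrite (mpolyE f); apply: (big_ind P) => [||m _]; first by rewrite -mpolyC0.
  exact: PD.
rewrite -mul_mpolyC; apply: (PM) => //; rewrite mpolyXE_id.
by apply: (big_ind P) => [||i _]; [exact: P1 | exact: PM | exact: PXn].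
Qed.

Definition rationally_connected : Prop := forall x y, O x -> O y ->
  exists (v : 'I_N -> {poly K}) (d : {poly K}),
  [/\ d.[0] != 0 /\ p x =1 (fun i => (v i).[0] / d.[0]),
      d.[1] != 0 /\ p y =1 (fun i => (v i).[1] / d.[1])
    & forall t, d.[t] != 0 ->
        exists2 z, O z & p z =1 (fun i => (v i).[t] / d.[t])].

(* [f] nonzero at [x] and [g] nonzero at [y] restrict to nonzero rational
   functions of the parameter of a curve joining [x] to [y]. *)
Lemma vanishing_ideal_prime : (exists x, O x) -> rationally_connected ->
  exists q : prime_idealr {mpoly K[N]},
    forall f, f \in q <-> forall x, O x -> meval (p x) f = 0.
Proof.
move=> [x0 Ox0] conn.
pose V : {pred {mpoly K[N]}} := fun f => `[< forall x, O x -> meval (p x) f = 0 >].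
have VP f : f \in V <-> forall x, O x -> meval (p x) f = 0 by split=> /asboolP.
have Vi : idealr_closed V.
  split; first by apply/VP => x _; rewrite meval0.
    by apply/negP => /VP/(_ _ Ox0)/eqP; rewrite meval1 oner_eq0.
  move=> a f g /VP Vf /VP Vg; apply/VP => x Ox.
  by rewrite mevalD mevalM (Vf _ Ox) (Vg _ Ox) mulr0 addr0.
have Vp : prime_idealr_closed V.
  move=> f g /VP Vfg; apply: contrapT => /negP; rewrite negb_or => /andP[nf ng].
  have Nz h : h \notin V -> exists2 x, O x & meval (p x) h != 0.
    move=> nh; apply: contrapT => Nx; move/negP: nh; apply; apply/VP => x Ox.
    by apply: contrapT => /eqP hx; apply: Nx; exists x.
  have [x Ox fx] := Nz _ nf; have [y Oy gy] := Nz _ ng.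
  have [v [d [[d0 vx] [d1 vy] vO]]] := conn _ _ Ox Oy.
  have [F [D FE]] := meval_curve f v d; have [G [E GE]] := meval_curve g v d.
  have F0 : F != 0.
    apply: contraNneq fx => F0; move/eqP: (FE _ d0).
    rewrite F0 horner0 eq_sym mulf_eq0 expf_eq0 (negPf d0) andbF /=.
    by rewrite (meval_eq _ vx).
  have G0 : G != 0.
    apply: contraNneq gy => G0; move/eqP: (GE _ d1).
    rewrite G0 horner0 eq_sym mulf_eq0 expf_eq0 (negPf d1) andbF /=.
    by rewrite (meval_eq _ vy).
  have dn0 : d != 0 by apply: contraNneq d0 => ->; rewrite horner0.
  (* At such a parameter the curve is at a point of [O] where neither [f] nor [g] vanishes. *)
  have [t] : exists t, (F * G * d).[t] != 0 by apply: exists_nonroot; rewrite !mulf_neq0.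
  rewrite !hornerM !mulf_eq0 !negb_or -andbA => /and3P[Ft Gt dt].
  have [z Oz pz] := vO _ dt; move/eqP: (Vfg _ Oz); rewrite mevalM mulf_eq0.
  rewrite !(meval_eq _ pz); case/orP => /eqP h0.
    by move: Ft; rewrite FE // h0 mulr0 eqxx.
  by move: Gt; rewrite GE // h0 mulr0 eqxx.
pose q : prime_idealr {mpoly K[N]} := HB.pack (V : {mpoly K[N]} -> bool)
  (isIdealr.Build _ V Vi) (isPrimeIdealrClosed.Build _ V Vp).
by exists q.
Qed.

End Vanishing.

(** * Invariant forms on sp(2r) *)

Lemma scalar0 (K : nzRingType) (U : lmodType K) (f : U -> K) :
  scalar f -> f 0 = 0.
Proof. by move=> fl; have := fl (-1) 0 0; rewrite scaler0 addr0 mulN1r addNr. Qed.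

Lemma scalar_sum (K : nzRingType) (U : lmodType K) (f : U -> K) (I : finType)
    (a : I -> K) (u : I -> U) :
  scalar f -> f (\sum_i a i *: u i) = \sum_i a i * f (u i).
Proof.
move=> fl; pose F : {scalar U} := HB.pack f (GRing.isLinear.Build K U K _ f fl).
rewrite -[f]/(F : U -> K) linear_sum /=; apply: eq_bigr => i _.
exact: (scalarZ F).
Qed.

Section SpTensor.
Variables (K : fieldType) (r : nat).
Local Notation J := (symplectic_mx K r).
Local Notation V := 'cV[K]_(r + r).
Implicit Types (u v w a : V) (x y : 'M[K]_(r + r)).

Definition is_sp x := x^T *m J = - (J *m x).

Definition omega u v : K := (u^T *m J *m v) 0 0.

Lemma omega_linearr u : scalar (omega u).
Proof. by move=> k v w; rewrite /omega mulmxDr -scalemxAr !mxE. Qed.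
HB.instance Definition _ u := GRing.isLinear.Build K V K _ (omega u) (omega_linearr u).

Lemma omegaC u v : omega v u = - omega u v.
Proof.
transitivity ((v^T *m J *m u)^T 0 0); first by rewrite [RHS]mxE.
by rewrite !trmx_mul trmxK symplectic_mx_tr mulNmx mulmxN mxE mulmxA.
Qed.

Lemma omega_linearl v : scalar (omega^~ v).
Proof. by move=> k u w; rewrite !(omegaC v) linearP /= opprD mulrN. Qed.

Lemma omegaDl u v w : omega (u + v) w = omega u w + omega v w.
Proof. by rewrite -[u]scale1r omega_linearl mul1r scale1r. Qed.

Lemma omegaZl k v w : omega (k *: v) w = k * omega v w.
Proof. by rewrite !(omegaC w) linearZ /= mulrN. Qed.

Lemma omega_nondeg v : v != 0 -> exists w, omega w v != 0.
Proof.
move=> v0; have : J *m v != 0.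
  apply: contraNneq v0 => Jv; apply/eqP/(can_inj (mulKmx (symplectic_mx_unit K r))).
  by rewrite Jv mulmx0.
case/cV0Pn => i Jvi; exists (delta_mx i 0).
by rewrite /omega trmx_delta -mulmxA -rowE mxE.
Qed.

(** A vector space is not the union of two hyperplanes. *)
Lemma omega_common u v : u != 0 -> v != 0 ->
  exists w, omega w u != 0 /\ omega w v != 0.
Proof.
move=> /omega_nondeg[w1 u1] /omega_nondeg[w2 v2].
have [v1|] := eqVneq (omega w1 v) 0; last by exists w1.
have [u2|] := eqVneq (omega w2 u) 0; last by exists w2.
by exists (w1 + w2); rewrite !omegaDl v1 u2 add0r addr0.
Qed.

(** A vector of the hyperplane orthogonal to [v] becomes generic after adding a [w] outside it, and
    [f] vanishes at both [w] and the sum. *)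
Lemma scalar_generic0 (f : V -> K) v : scalar f -> v != 0 ->
  (forall a, omega a v != 0 -> f a = 0) -> forall a, f a = 0.
Proof.
move=> fl /omega_nondeg[w wv] f0 a; have [av|] := eqVneq (omega a v) 0; last exact: f0.
have := fl 1 a w; rewrite f0; last by rewrite scale1r omegaDl av add0r.
by rewrite (f0 w wv) mul1r addr0 => <-.
Qed.

Lemma bilinear_generic0 (f : V -> V -> K) :
  (forall v, scalar (f^~ v)) -> (forall u, scalar (f u)) ->
  (forall u v, omega u v != 0 -> f u v = 0) -> forall u v, f u v = 0.
Proof.
move=> fl fr f0 u v; have [->|v0] := eqVneq v 0.
  exact: scalar0 (fr u).
exact: (scalar_generic0 (fl v) v0 (f0^~ v)).
Qed.

(** Image of the product [u v] under the isomorphism from the symmetric square of V to sp(V). *)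
Definition sp_tensor u v : 'M[K]_(r + r) := (u *m v^T + v *m u^T) *m J.

Lemma sp_tensorC u v : sp_tensor u v = sp_tensor v u.
Proof. by rewrite /sp_tensor addrC. Qed.

Lemma sp_tensor_linearr u : linear (sp_tensor u).
Proof.
move=> k v w; rewrite /sp_tensor scalemxAl -mulmxDl scalerDr addrACA.
by congr (_ *m J); rewrite linearP /= mulmxDr mulmxDl -scalemxAr -scalemxAl.
Qed.
HB.instance Definition _ u :=
  GRing.isLinear.Build K V 'M[K]_(r + r) _ (sp_tensor u) (sp_tensor_linearr u).

Lemma sp_tensor_linearl v : linear (sp_tensor^~ v).
Proof. by move=> k u w; rewrite !(sp_tensorC _ v) linearP. Qed.

Lemma sp_tensor_linearlZ k u v : sp_tensor (k *: u) v = k *: sp_tensor u v.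
Proof. by rewrite !(sp_tensorC _ v) linearZ. Qed.

Lemma sp_tensor_sp u v : is_sp (sp_tensor u v).
Proof.
rewrite /is_sp trmx_mul symplectic_mx_tr linearD /= !trmx_mul !trmxK.
by rewrite !mulNmx mulmxA addrC.
Qed.

Lemma sp_tensor_mul u v w :
  sp_tensor u v *m w = omega v w *: u + omega u w *: v.
Proof.
rewrite /sp_tensor -mulmxA mulmxDl -!mulmxA ![_^T *m (J *m w)]mulmxA.
rewrite [v^T *m J *m w]mx11_scalar [u^T *m J *m w]mx11_scalar.
by rewrite !mul_mx_scalar.
Qed.

(** Equivariance of the map from the symmetric square: [J x = - x^T J] carries [x] across [J] onto
    the transposed vectors. *)
Lemma sp_tensor_bracket x u v : is_sp x ->
  x *m sp_tensor u v - sp_tensor u v *m x =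
    sp_tensor (x *m u) v + sp_tensor u (x *m v).
Proof.
move=> Sx; have Jx : J *m x = - (x^T *m J) by rewrite Sx opprK.
rewrite /sp_tensor -[_ *m J *m x]mulmxA Jx mulmxN opprK mulmxA mulmxA -!mulmxDl.
congr (_ *m J); rewrite mulmxDr [(_ + _) *m x^T]mulmxDl !trmx_mul !mulmxA.
by rewrite -!addrA; congr (_ + _); rewrite [RHS]addrCA addrC -addrA.
Qed.

Hypothesis two_neq0 : 2 != 0 :> K.

(** Here [x = A J] with [A = - (x J)] symmetric, and a symmetric matrix is half the sum of the
    symmetrised elementary matrices weighted by its entries. *)
Lemma sp_tensor_span (f : 'M[K]_(r + r) -> K) : scalar f ->
  (forall u v, f (sp_tensor u v) = 0) -> forall x, is_sp x -> f x = 0.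
Proof.
move=> fl f0 x Sx; pose A := - (x *m J).
have AT : A^T = A.
  by rewrite /A linearN /= trmx_mul symplectic_mx_tr mulNmx opprK sp_mulJtr.
have -> : x = \sum_i \sum_j
    (2^-1 * A i j) *: sp_tensor (delta_mx i 0) (delta_mx j 0).
  transitivity (2^-1 *: ((A + A^T) *m J)).
    rewrite AT -mulr2n -scaler_nat.
    rewrite -scalemxAl scalerA mulVf // scale1r mulNmx -mulmxA symplectic_mxK.
    by rewrite mulmxN mulmx1 opprK.
  rewrite {1 2}[A]matrix_sum_delta linear_sum /= -big_split /= mulmx_suml scaler_sumr.
  apply: eq_bigr => i _; rewrite linear_sum /= -big_split /= mulmx_suml scaler_sumr.
  apply: eq_bigr => j _; rewrite linearZ /= -scalerDr -scalemxAl scalerA /sp_tensor.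
  by rewrite !trmx_delta !mul_delta_mx.
have f00 := scalar0 fl.
have fD y z : f y = 0 -> f z = 0 -> f (y + z) = 0.
  by move=> fy fz; rewrite -[y]scale1r fl fy fz mulr0 addr0.
apply: (big_ind (fun y => f y = 0)) => // i _.
apply: (big_ind (fun y => f y = 0)) => // j _.
by rewrite -[X in f X]addr0 fl f0 f00 mulr0 addr0.
Qed.

Variable b : 'M[K]_(r + r) -> 'M[K]_(r + r) -> K.
Hypotheses (bl : forall y, scalar (b^~ y)) (br : forall x, scalar (b x)).
Hypothesis binv : forall x y z, is_sp x -> is_sp y -> is_sp z ->
  b (x *m y - y *m x) z = b x (y *m z - z *m y).

Let b0r x : b x 0 = 0.
Proof. exact: scalar0 (br x). Qed.
Let bDr x y z : b x (y + z) = b x y + b x z.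
Proof. by have := br x 1 y z; rewrite scale1r mul1r. Qed.
Let bZr k x y : b x (k *: y) = k * b x y.
Proof. by have := br x k y 0; rewrite b0r !addr0. Qed.
Let b0l x : b 0 x = 0.
Proof. exact: scalar0 (bl x). Qed.
Let bDl x y z : b (x + y) z = b x z + b y z.
Proof. by have := bl z 1 x y; rewrite scale1r mul1r. Qed.
Let bZl k x y : b (k *: x) y = k * b x y.
Proof. by have := bl y k x 0; rewrite b0l !addr0. Qed.

(** Invariance for [x], [sp_tensor v v] and [sp_tensor u u], divided by two. When [omega v u] is
    nonzero, it reduces [b x (sp_tensor v u)] to values on pairs of tensors. *)
Lemma sp_form_square x u v : is_sp x ->
  b (sp_tensor (x *m v) v) (sp_tensor u u) = 2 * omega v u * b x (sp_tensor v u).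
Proof.
move=> Sx; have := binv Sx (sp_tensor_sp v v) (sp_tensor_sp u u).
rewrite !sp_tensor_bracket //; try exact: sp_tensor_sp.
rewrite (sp_tensorC v) (sp_tensorC u) !bDl !bDr sp_tensor_mul.
rewrite -scalerDl sp_tensor_linearlZ !bZr => H.
apply: (mulfI two_neq0); set t := b (sp_tensor _ _) _ in H *.
by rewrite (_ : 2 * t = t + t); [rewrite H; ring | ring].
Qed.

(** For [x = sp_tensor a a], the vector [x v] is [2 omega(a, v) a], so [sp_form_square] settles
    every [a] not orthogonal to [v]; linearity in [a] does the rest. *)
Lemma sp_form_orth u v a : omega v u = 0 -> b (sp_tensor a v) (sp_tensor u u) = 0.
Proof.
move=> vu; have [->|v0] := eqVneq v 0; first by rewrite linear0 b0l.
pose f a := b (sp_tensor a v) (sp_tensor u u).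
have fl : scalar f by move=> k a1 a2; rewrite /f sp_tensor_linearl bDl bZl.
apply: (scalar_generic0 fl v0) => {}a av; rewrite /f.
have := @sp_form_square (sp_tensor a a) u v (sp_tensor_sp a a).
rewrite vu mulr0 mul0r sp_tensor_mul -scalerDl sp_tensor_linearlZ bZl => /eqP.
by rewrite mulf_eq0 -mulr2n -mulr_natl mulf_eq0 (negPf two_neq0) (negPf av) => /eqP.
Qed.

(** By [sp_form_orth] the form in [a] and [v] factors through the quotient of V by the hyperplane
    orthogonal to [u]. This is a line, so one value at a [w] outside the hyperplane fixes the
    constant. *)
Lemma sp_form_tensor_square u : exists c, forall a v,
  b (sp_tensor a v) (sp_tensor u u) = c * omega a u * omega v u.
Proof.
have [->|u0] := eqVneq u 0.
  by exists 0 => a v; rewrite linear0 b0r !mul0r.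
have [w wu] := omega_nondeg u0.
exists (b (sp_tensor w w) (sp_tensor u u) / omega w u ^+ 2) => a v.
have dec z : exists2 z0, omega z0 u = 0 & z = z0 + (omega z u / omega w u) *: w.
  exists (z - (omega z u / omega w u) *: w); last by rewrite subrK.
  by rewrite -scaleNr omegaDl omegaZl mulNr divfK // subrr.
have [a0 a0u ->] := dec a; have [v0 v0u ->] := dec v.
rewrite !omegaDl !omegaZl a0u v0u !add0r !divfK //.
rewrite linearD /= bDl sp_form_orth // add0r sp_tensorC linearD /= bDl.
rewrite sp_form_orth // add0r sp_tensorC sp_tensor_linearlZ linearZ /= !bZl.
by field.
Qed.

(* Comparing the two ways of moving a bracket across the form shows that the
   constant attached to [u] does not depend on [u]. *)
Lemma sp_form_tensor : exists c, forall u a v,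
  b (sp_tensor a v) (sp_tensor u u) = c * omega a u * omega v u.
Proof.
have [n0|[u0 u00]] : (forall u : V, u = 0) \/ exists u : V, u != 0.
  have [n0|] := eqVneq (const_mx 1 : V) 0; last by right; exists (const_mx 1).
  left => u; apply/matrixP => i j; move/matrixP/(_ i j)/eqP: n0.
  by rewrite !mxE oner_eq0.
  by exists 0 => u a v; rewrite [u]n0 linear0 b0r !mul0r.
have [c0 Hc0] := sp_form_tensor_square u0; exists c0 => u a v.
have key u1 u2 c1 c2 : omega u1 u2 != 0 ->
    (forall a v, b (sp_tensor a v) (sp_tensor u1 u1) = c1 * omega a u1 * omega v u1) ->
    (forall a v, b (sp_tensor a v) (sp_tensor u2 u2) = c2 * omega a u2 * omega v u2) ->
    c1 = c2.
  move=> u12 H1 H2; have u21 : omega u2 u1 != 0 by rewrite omegaC oppr_eq0.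
  have diag (y z w : V) k : omega z y != 0 ->
      (forall a v, b (sp_tensor a v) (sp_tensor y y) = k * omega a y * omega v y) ->
      b (sp_tensor w w) (sp_tensor z y) = k * omega w y * omega w z.
    move=> zy Hk; have := @sp_form_square (sp_tensor w w) y z (sp_tensor_sp w w).
    rewrite Hk sp_tensor_mul -scalerDl omegaZl => H.
    by apply: (mulfI (mulf_neq0 two_neq0 zy)); rewrite -H; ring.
  (* At [u1 + u2] the same number is both [c1] and [c2] times the nonzero product
     [omega u1 u2 * omega u2 u1]. *)
  have := diag u1 u2 (u1 + u2) c1 u21 H1.
  rewrite sp_tensorC (diag u2 u1 (u1 + u2) c2 u12 H2) => /eqP.
  have o0 z : omega z z = 0.
    have /eqP := omegaC z z; rewrite -subr_eq0 opprK -mulr2n -mulr_natl mulf_eq0.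
    by rewrite (negPf two_neq0) => /eqP.
  rewrite !omegaDl !o0 add0r addr0 -mulrA [_ * omega u2 u1 * _]mulrAC -mulrA => /eqP.
  by move/(mulIf (mulf_neq0 u12 u21)).
have [->|un0] := eqVneq u 0.
  by rewrite linear0 b0r -[omega a 0]/(omega a 0) linear0 mulr0 mul0r.
(* As [u] and [u0] may be orthogonal, their constants are compared through a [w] orthogonal to
   neither. *)
have [w [wu wu0]] := omega_common un0 u00.
have [c Hc] := sp_form_tensor_square u; have [c1 Hc1] := sp_form_tensor_square w.
by rewrite Hc -(key _ _ _ _ wu0 Hc1 Hc0) (key _ _ _ _ wu Hc1 Hc).
Qed.

(** When [omega u v] is nonzero, [sp_form_square] and [sp_form_tensor] give the value, the factor
    two there turning the constant into [c / 2]. Bilinearity in [u] and [v] removes the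
    condition. *)
Lemma sp_invariant_form : exists c, forall x u v, is_sp x ->
  b x (sp_tensor u v) = c * omega (x *m u) v.
Proof.
have [c Hc] := sp_form_tensor; exists (c / 2) => x u v Sx; apply/eqP.
rewrite -subr_eq0; apply/eqP.
pose f u v := b x (sp_tensor u v) - c / 2 * omega (x *m u) v.
apply: (bilinear_generic0 (f := f)); rewrite /f.
- move=> {}v k a a'; rewrite sp_tensor_linearl bDr bZr.
  by rewrite mulmxDr -scalemxAr omegaDl omegaZl; ring.
- by move=> {}u k a a'; rewrite linearP /= bDr bZr linearP /=; ring.
move=> {}u {}v uv; apply: (mulfI (mulf_neq0 two_neq0 uv)).
have := @sp_form_square x v u Sx; rewrite Hc mulr0 mulrBr => <-.
by field.
Qed.

End SpTensor.

(** * Gram matrices and block coordinates on osp(m,2r) *)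

(** The Gram matrix of [e] is [P G P^T]. Used in both directions, this replaces an abstract basis by
    an explicit spanning family. *)
Lemma gram_rank_le (K : fieldType) (U : lmodType K) (beta : U -> U -> K)
    (betal : forall v, scalar (beta^~ v)) (betar : forall u, scalar (beta u))
    m n (e : 'I_m -> U) (f : 'I_n -> U) (P : 'M[K]_(m, n)) :
  (forall i, e i = \sum_s P i s *: f s) ->
  (\rank (\matrix_(i, j) beta (e i) (e j)) <=
     \rank (\matrix_(s, t) beta (f s) (f t)))%N.
Proof.
move=> eP; pose G := \matrix_(s, t) beta (f s) (f t).
rewrite -/G (_ : \matrix_(i, j) _ = P *m G *m P^T).
  exact: leq_trans (mxrankM_maxl _ _) (mxrankM_maxr _ _).
apply/matrixP => i j; rewrite !mxE (eP j) scalar_sum //; apply: eq_bigr => t _.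
rewrite !mxE mulrC; congr (_ * _); rewrite (eP i) (scalar_sum _ _ (betal _)).
by apply: eq_bigr => s _; rewrite !mxE.
Qed.

Section OspCoordinates.
Variables (K : fieldType) (m r : nat).
Hypothesis two_neq0 : 2 != 0 :> K.
Local Notation n := (r + r)%N.
Local Notation J := (symplectic_mx K r).
Local Notation g := (osp K m r).

Let opp0 p q (A : 'M[K]_(p, q)) : A = - A -> A = 0.
Proof.
move/eqP; rewrite -subr_eq0 opprK -mulr2n -scaler_nat scaler_eq0.
by rewrite (negPf two_neq0) => /eqP.
Qed.

Lemma osp_evenP (a : 'M[K]_m) (y : 'M[K]_n) : a^T = - a -> is_sp y ->
  block_mx a 0 0 y \in osp_part K m r false.
Proof.
move=> aT Sy; apply/osp_partP; rewrite scale1r /parity_mx /osp_form.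
rewrite tr_block_mx /= mul1mx !mulmx_block.
rewrite !(mulmx0, mul0mx, mulmx1, mul1mx, addr0, add0r, trmx0, mulmxN, mulNmx, oppr0).
by split=> //; rewrite aT Sy opp_block_mx !oppr0.
Qed.

Lemma osp_even_blockP (X : 'M[K]_(m + n)) : X \in osp_part K m r false ->
  exists a y, [/\ X = block_mx a 0 0 y, a^T = - a & is_sp y].
Proof.
move=> /osp_partP; rewrite -(submxK X); set a := ulsubmx X; set y := drsubmx X.
rewrite scale1r /parity_mx /osp_form tr_block_mx /= mul1mx !mulmx_block.
rewrite !(mulmx0, mul0mx, mulmx1, mul1mx, addr0, add0r, trmx0, mulmxN, mulNmx, oppr0).
case=> /eq_block_mx[_ /opp0 -> /esym/opp0 -> _].
rewrite !(mulmx0, mul0mx, trmx0) opp_block_mx => /eq_block_mx[aT _ _ Sy].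
by exists a, y.
Qed.

Lemma osp_oddP (c : 'M[K]_(n, m)) :
  block_mx 0 (- (c^T *m J)) c 0 \in osp_part K m r true.
Proof.
apply/osp_partP; rewrite expr1 scaleN1r /parity_mx /osp_form tr_block_mx !mulmx_block.
rewrite !(mulmx0, mul0mx, mulmx1, mul1mx, addr0, add0r, trmx0, mulmxN, mulNmx, oppr0).
rewrite !opp_block_mx !oppr0 !opprK; split=> //; congr block_mx.
by rewrite linearN /= trmx_mul trmxK symplectic_mx_tr mulNmx opprK.
Qed.

Lemma osp_odd_blockP (X : 'M[K]_(m + n)) : X \in osp_part K m r true ->
  exists c, X = block_mx 0 (- (c^T *m J)) c 0.
Proof.
move=> /osp_partP; rewrite -(submxK X); set c := dlsubmx X; set d := ursubmx X.
rewrite expr1 scaleN1r /parity_mx /osp_form tr_block_mx !mulmx_block.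
rewrite !(mulmx0, mul0mx, mulmx1, mul1mx, addr0, add0r, trmx0, mulmxN, mulNmx, oppr0).
rewrite opp_block_mx => -[/eq_block_mx[/opp0 -> _ _]].
rewrite opprK => /esym/opp0 ->.
rewrite !(mulmx0, mul0mx, trmx0) opp_block_mx => /eq_block_mx[_ cd _ _].
by exists c; rewrite cd opprK.
Qed.

(** The projection makes this total, hence linear in all block matrices; the block matrix itself is
    recovered when [a] is skew and [y] is in sp(2r). *)
Definition osp_even_elt (a : 'M[K]_m) (y : 'M[K]_n) : even g :=
  vsproj (osp_part K m r false) (block_mx a 0 0 y).

Definition osp_odd_elt (c : 'M[K]_(n, m)) : Defs.odd g :=
  vsproj (osp_part K m r true) (block_mx 0 (- (c^T *m J)) c 0).

Lemma vsval_osp_odd_elt c :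
  vsval (osp_odd_elt c : subvs_of (osp_part K m r true)) = block_mx 0 (- (c^T *m J)) c 0.
Proof. by rewrite vsprojK ?osp_oddP. Qed.

Lemma vsval_osp_even_elt a y : a^T = - a -> is_sp y ->
  vsval (osp_even_elt a y : subvs_of (osp_part K m r false)) = block_mx a 0 0 y.
Proof. by move=> aT Sy; rewrite vsprojK ?osp_evenP. Qed.

Lemma osp_even_eltP (x : even g) :
  exists a y, [/\ x = osp_even_elt a y, a^T = - a & is_sp y].
Proof.
have [a [y [xE aT Sy]]] := osp_even_blockP (subvsP (x : subvs_of (osp_part K m r false))).
exists a, y; split=> //; apply: (@ospval_inj K m r false).
by rewrite vsval_osp_even_elt.
Qed.

Lemma osp_odd_eltP (x : Defs.odd g) : exists c, x = osp_odd_elt c.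
Proof.
have [c xE] := osp_odd_blockP (subvsP (x : subvs_of (osp_part K m r true))).
by exists c; apply: (@ospval_inj K m r true); rewrite vsval_osp_odd_elt.
Qed.

Lemma osp_odd_elt_linear : linear osp_odd_elt.
Proof.
move=> k c d; apply: (@ospval_inj K m r true).
rewrite [RHS]linearP /= !vsval_osp_odd_elt scale_block_mx add_block_mx !scaler0 !addr0.
congr block_mx; rewrite linearP /= mulmxDl opprD -scalemxAl.
by rewrite scalerN.
Qed.
HB.instance Definition _ := GRing.isLinear.Build K 'M[K]_(n, m) (Defs.odd g) _
  osp_odd_elt osp_odd_elt_linear.

Lemma osp_even_elt_linear2 k a a' y y' :
  osp_even_elt (k *: a + a') (k *: y + y') = k *: osp_even_elt a y + osp_even_elt a' y'.
Proof.
rewrite /osp_even_elt -linearP /=; congr vsproj.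
by rewrite scale_block_mx add_block_mx !scaler0 !addr0.
Qed.

Lemma br11_osp_odd_elt c d : br11 (osp_odd_elt c) (osp_odd_elt d) =
  osp_even_elt (- (c^T *m J *m d + d^T *m J *m c))
               (- ((c *m d^T + d *m c^T) *m J)).
Proof.
have Eb : superbracket true true (block_mx 0 (- (c^T *m J)) c 0)
      (block_mx 0 (- (d^T *m J)) d 0) =
    block_mx (- (c^T *m J *m d + d^T *m J *m c)) 0 0
             (- ((c *m d^T + d *m c^T) *m J)).
  rewrite /superbracket /= expr1 scaleN1r opprK !mulmx_block.
  rewrite !(mulmx0, mul0mx, addr0, add0r, mulmxN, mulNmx) add_block_mx !addr0.
  by rewrite [(_ + _) *m J]mulmxDl !opprD !mulmxA.
apply: (@ospval_inj K m r false).
rewrite [LHS](@vsval_osp_br K m r true true) !vsval_osp_odd_elt vsprojK ?Eb // -Eb.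
by apply: (@superbracket_part K m r true true); apply: osp_oddP.
Qed.

Lemma br00_osp_even_elt a a' y y' : a^T = - a -> is_sp y -> a'^T = - a' -> is_sp y' ->
  br00 (osp_even_elt a y) (osp_even_elt a' y') =
  osp_even_elt (a *m a' - a' *m a) (y *m y' - y' *m y).
Proof.
move=> aT Sy aT' Sy'; apply: (@ospval_inj K m r false).
have Eb : superbracket false false (block_mx a 0 0 y) (block_mx a' 0 0 y') =
    block_mx (a *m a' - a' *m a) 0 0 (y *m y' - y' *m y).
  rewrite /superbracket /= scale1r !mulmx_block.
  by rewrite !(mulmx0, mul0mx, addr0, add0r) opp_block_mx add_block_mx !subr0.
rewrite [LHS](@vsval_osp_br K m r false false) (vsval_osp_even_elt aT Sy).
rewrite (vsval_osp_even_elt aT' Sy') vsprojK ?Eb // -Eb.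
by apply: (@superbracket_part K m r false false); apply: osp_evenP.
Qed.

Variable B : even g -> even g -> K.
Hypothesis Binv : nondegenerate_invariant_form B.

Let Bl y : scalar (B^~ y). Proof. by case: Binv. Qed.
Let Br x : scalar (B x). Proof. by case: Binv. Qed.
Let B0r x : B x 0 = 0.
Proof. exact: scalar0 (Br x). Qed.

Lemma osp_even_elt0 : osp_even_elt 0 0 = 0.
Proof.
have := osp_even_elt_linear2 (-1) 0 0 0 0.
by rewrite !scaler0 !addr0 scaleN1r addNr.
Qed.

Lemma osp_even_eltD a y : osp_even_elt a y = osp_even_elt a 0 + osp_even_elt 0 y.
Proof. by have := osp_even_elt_linear2 1 a 0 0 y; rewrite !scale1r addr0 add0r. Qed.

Lemma osp_even_elt_linear k y y' :
  osp_even_elt 0 (k *: y + y') = k *: osp_even_elt 0 y + osp_even_elt 0 y'.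
Proof. by have := osp_even_elt_linear2 k 0 0 y y'; rewrite scaler0 addr0. Qed.

Let tr0 : (0 : 'M[K]_m)^T = - 0. Proof. by rewrite trmx0 oppr0. Qed.
Let sp0 : is_sp (0 : 'M[K]_n).
Proof. by rewrite /is_sp trmx0 mul0mx mulmx0 oppr0. Qed.

Lemma osp_form_sp : exists c, forall y u v, is_sp y ->
  B (osp_even_elt 0 y) (osp_even_elt 0 (sp_tensor u v)) = c * omega (y *m u) v.
Proof.
pose b y z := B (osp_even_elt 0 y) (osp_even_elt 0 z).
apply: (sp_invariant_form two_neq0 (b := b)); rewrite /b.
- by move=> z k y y'; rewrite osp_even_elt_linear; apply: Bl.
- by move=> z k y y'; rewrite osp_even_elt_linear; apply: Br.
move=> x y z Sx Sy Sz; case: Binv => _ _ inv _.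
have E y1 y2 : is_sp y1 -> is_sp y2 -> osp_even_elt 0 (y1 *m y2 - y2 *m y1) =
    br00 (osp_even_elt 0 y1) (osp_even_elt 0 y2).
  by move=> S1 S2; rewrite br00_osp_even_elt // mulmx0 subr0.
by rewrite !E.
Qed.

(** The bracket of [sp_tensor u u] and [sp_tensor v v] is [4 omega(u, v)] times [sp_tensor u v], so
    brackets span sp(2r). Invariance moves a bracket onto so(m), which commutes with sp(2r). *)
Lemma osp_form_sp_so y a : is_sp y -> a^T = - a ->
  B (osp_even_elt 0 y) (osp_even_elt a 0) = 0.
Proof.
move=> Sy aT; pose f z := B (osp_even_elt 0 z) (osp_even_elt a 0).
have fl : scalar f.
  by move=> k z z'; rewrite /f osp_even_elt_linear; apply: Bl.
have f0 := scalar0 fl.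
apply: (sp_tensor_span two_neq0 fl _ Sy); apply: bilinear_generic0.
- by move=> v k u u'; rewrite sp_tensor_linearl fl.
- by move=> u k v v'; rewrite linearP fl.
move=> u v uv.
have : f (sp_tensor u u *m sp_tensor v v - sp_tensor v v *m sp_tensor u u) = 0.
  have := @br00_osp_even_elt 0 0 _ _ tr0 (sp_tensor_sp u u) tr0 (sp_tensor_sp v v).
  rewrite mulmx0 subr0 /f => <-; case: Binv => _ _ -> _.
  rewrite br00_osp_even_elt //; try exact: sp_tensor_sp.
  by rewrite !(mulmx0, mul0mx) !subr0 osp_even_elt0 B0r.
rewrite sp_tensor_bracket; last exact: sp_tensor_sp.
rewrite sp_tensor_mul -scalerDl sp_tensor_linearlZ linearZ /= sp_tensorC -scalerDl.
rewrite -[X in f X]addr0 fl f0 addr0 => /eqP.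
rewrite mulf_eq0 -!mulr2n -mulrnA -mulr_natl mulf_eq0 (natrM _ 2 2) mulf_eq0.
by rewrite (negPf two_neq0) (negPf uv) sp_tensorC => /eqP.
Qed.

Lemma osp_form_odd : (0 < r)%N -> exists2 c, c != 0 & forall y c1 c2, is_sp y ->
  B (osp_even_elt 0 y) (br11 (osp_odd_elt c1) (osp_odd_elt c2)) =
  c * \sum_k omega (y *m col k c1) (col k c2).
Proof.
(* The sign is that of the sp-component of the odd bracket. If [c] were zero, [sp_tensor u u] would
   be orthogonal to the whole even part, hence zero, although it sends [w] to a nonzero multiple of
   [u]. *)
move=> r0; have [c Hc] := osp_form_sp; exists (- c).
  rewrite oppr_eq0; apply/eqP => c0.
  pose u : 'cV[K]_n := const_mx 1.
  have u0 : u != 0.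
    apply/cV0Pn; exists (lshift r (Ordinal r0)); rewrite mxE oner_neq0 //.
  have [w wu] := omega_nondeg u0.
  have Suu := sp_tensor_sp u u.
  have : osp_even_elt 0 (sp_tensor u u) = 0.
    case: Binv => _ _ _; apply=> x; have [a [y [-> aT Sy]]] := osp_even_eltP x.
    rewrite (osp_even_eltD a) -[osp_even_elt a 0]scale1r Br osp_form_sp_so // mulr0 add0r.
    pose f z := B (osp_even_elt 0 (sp_tensor u u)) (osp_even_elt 0 z).
    apply: (sp_tensor_span two_neq0 (f := f)) => // [k z z'|v v']; rewrite /f.
      by rewrite osp_even_elt_linear; apply: Br.
    by rewrite Hc // c0 mul0r.
  pose block (x : even g) : 'M[K]_n :=
    drsubmx (vsval (x : subvs_of (osp_part K m r false)) : 'M[K]_(m + n)).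
  move/(congr1 block); rewrite /block.
  rewrite vsval_osp_even_elt // block_mxKdr [X in drsubmx X](ospval0 K m r false) => S0.
  have : sp_tensor u u *m w = 0.
    by rewrite S0 (_ : drsubmx 0 = 0) ?mul0mx //; apply/matrixP => i j; rewrite !mxE.
  rewrite sp_tensor_mul -scalerDl => /eqP; rewrite scaler_eq0 (negPf u0) orbF.
  rewrite -mulr2n -mulr_natl mulf_eq0 (negPf two_neq0) omegaC oppr_eq0 /=.
  by rewrite (negPf wu).
(* The so-component of the bracket is orthogonal to [y]; the sp-component is then split along the
   columns of [c1] and [c2]. *)
move=> y c1 c2 Sy; rewrite br11_osp_odd_elt (osp_even_eltD (- _)).
rewrite -[osp_even_elt _ 0]scale1r Br osp_form_sp_so //; last first.
  rewrite linearN linearD /= !trmx_mul !trmxK symplectic_mx_tr !mulNmx !mulmxN.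
  by rewrite -opprD !opprK addrC !mulmxA.
rewrite mulr0 add0r.
have -> : - ((c1 *m c2^T + c2 *m c1^T) *m J) =
    \sum_k (-1) *: sp_tensor (col k c1) (col k c2).
  rewrite -scaler_sumr scaleN1r -mulmx_suml big_split /=; congr (- (_ *m _)).
  have E p q s (A : 'M[K]_(p, q)) (A' : 'M[K]_(s, q)) :
      A *m A'^T = \sum_k col k A *m (col k A')^T.
    apply/matrixP => i j; rewrite summxE !mxE; apply: eq_bigr => k _.
    by rewrite !mxE big_ord1 !mxE.
  by rewrite !E.
pose f z := B (osp_even_elt 0 y) (osp_even_elt 0 z).
have fl : scalar f.
  by move=> k z z'; rewrite /f osp_even_elt_linear; apply: Br.
rewrite -/(f _) (scalar_sum _ _ fl) mulr_sumr; apply: eq_bigr => k _.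
by rewrite /f Hc // mulN1r mulNr.
Qed.

End OspCoordinates.

(** * Rank of the odd bracket form at a point *)

Section GramRank.
Variables (K : fieldType) (m r : nat).
Hypothesis two_neq0 : 2 != 0 :> K.
Local Notation n := (r + r)%N.
Local Notation J := (symplectic_mx K r).
Local Notation g := (osp K m r).
Variable B : even g -> even g -> K.
Hypothesis Binv : nondegenerate_invariant_form B.

(** On the images of the elementary matrices, grouped by column, the Gram matrix is block diagonal
    with [m] copies of [c y^T J], each of rank [\rank y]. *)
Lemma osp_gram_rank y : (0 < r)%N -> is_sp y ->
  \rank (\matrix_(i < \dim {: Defs.odd g}, j < \dim {: Defs.odd g}) B (osp_even_elt 0 y)
     (br11 (vbasis {: Defs.odd g})`_i (vbasis {: Defs.odd g})`_j)) = (m * \rank y)%N.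
Proof.
move=> r0 Sy; have [c c0 Hc] := osp_form_odd two_neq0 Binv r0.
pose beta (v w : Defs.odd g) := B (osp_even_elt 0 y) (br11 v w).
have betal w : scalar (beta^~ w).
  by move=> k v v'; rewrite /beta br11_linearl; case: Binv => _ ->.
have betar v : scalar (beta v).
  by move=> k w w'; rewrite /beta br11_linearr; case: Binv => _ ->.
pose e (i : 'I_(\dim {: Defs.odd g})) : Defs.odd g := (vbasis {: Defs.odd g})`_i.
(* Pairs of a column and a row are indexed as in [\mxdiag], so that the Gram matrix can be compared
   with it entrywise. *)
pose E (s : 'I_(\sum_(k < m) n)) : 'M[K]_(n, m) :=
  delta_mx (tagnat.sig2 s) (tagnat.sig1 s).
pose f s : Defs.odd g := osp_odd_elt (E s).
rewrite -/(beta _ _) (_ : \matrix_(i, j) _ = \matrix_(i, j) beta (e i) (e j)) //.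
have eP : exists P : 'M_(_, _), forall i, e i = \sum_s P i s *: f s.
  have ch i : exists C : 'M[K]_(n, m), e i == osp_odd_elt C.
    by have [C ->] := osp_odd_eltP two_neq0 (e i); exists C.
  exists (\matrix_(i, s) xchoose (ch i) (tagnat.sig2 s) (tagnat.sig1 s)) => i.
  rewrite {1}(eqP (xchooseP (ch i))); set C := xchoose _.
  transitivity (osp_odd_elt (\sum_s C (tagnat.sig2 s) (tagnat.sig1 s) *: E s)); last first.
    by rewrite linear_sum; apply: eq_bigr => s _; rewrite linearZ mxE.
  congr osp_odd_elt.
  rewrite {1}[C]matrix_sum_delta exchange_big /= sig_big_dep /=.
  by rewrite (reindex _ tagnat.sig_bij_on).
have fP : exists Q : 'M_(_, _), forall s, f s = \sum_i Q s i *: e i.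
  exists (\matrix_(s, i) coord (vbasis {: Defs.odd g}) i (f s)) => s.
  rewrite {1}(coord_vbasis (memvf (f s))).
  by apply: eq_bigr => i _; rewrite mxE.
have [P {}eP] := eP; have [Q {}fP] := fP.
transitivity (\rank (\matrix_(s, t) beta (f s) (f t))).
  by apply/anti_leq; rewrite (gram_rank_le betal betar eP) (gram_rank_le betal betar fP).
transitivity (\rank (\mxdiag_(k < m) (c *: (y^T *m J)))).
  congr (\rank _); apply/matrixP => s t; rewrite !mxE /beta Hc //.
  have -> : \sum_k omega (y *m col k (E s)) (col k (E t)) =
      (tagnat.sig1 s == tagnat.sig1 t)%:R * (y^T *m J) (tagnat.sig2 s) (tagnat.sig2 t).
    have col_delta i j k :
        col k (delta_mx i j : 'M[K]_(n, m)) = (k == j)%:R *: delta_mx i 0.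
      apply/matrixP => p q; rewrite !mxE ord1 eqxx andbT andbC.
      by case: (k == j); rewrite ?mul1r ?mul0r.
    rewrite (bigD1 (tagnat.sig1 s)) //= big1 => [|k ks]; last first.
      by rewrite col_delta (negPf ks) scale0r mulmx0 /omega trmx0 !mul0mx mxE.
    rewrite addr0 !col_delta eqxx scale1r linearZ /=; congr (_ * _).
    by rewrite /omega trmx_mul trmx_delta -!mulmxA -rowE mulmxA -colE !mxE.
  case: (_ == _); last by rewrite mul0r mulr0 mxE.
  by rewrite conform_mx_id mul1r [RHS]mxE.
rewrite rank_mxdiag sum_nat_const card_ord; congr (_ * _)%N.
rewrite (eqmx_scale _ c0) mxrankMfree ?mxrank_tr // row_free_unit.
exact: symplectic_mx_unit.
Qed.

Lemma meval_even_to_sym (x z : even g) :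
  meval (fun i => B x (vbasis {: even g})`_i) (even_to_sym z) = B x z.
Proof.
have Br : scalar (B x) by case: Binv.
rewrite /even_to_sym [LHS]raddf_sum [in RHS](coord_vbasis (memvf z)) (scalar_sum _ _ Br).
by apply: eq_bigr => i _ /=; rewrite mevalZ mevalXU.
Qed.

End GramRank.

(** * Rational connectedness of the orbits *)

Section OrbitCurve.
Variables (K : numClosedFieldType) (m r : nat) (mu : seq nat).
Local Notation n := (r + r)%N.
Local Notation J := (symplectic_mx K r).
Local Notation g := (osp K m r).
Local Notation "M ^P" := (map_mx polyC M) (at level 2, format "M ^P").

Let two_neq0 : 2 != 0 :> K. Proof. by rewrite pnatr_eq0. Qed.

Lemma osp_orbitP (x : even g) : osp_orbit mu x <->
  exists y, [/\ x = osp_even_elt 0 y, is_sp y & has_jordan_type y mu].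
Proof.
split=> [|[y [-> Sy jy]]]; last first.
  rewrite /osp_orbit vsval_osp_even_elt ?trmx0 ?oppr0 //.
  by rewrite block_mxKul block_mxKdr.
have [a [y [-> aT Sy]]] := osp_even_eltP two_neq0 x.
rewrite /osp_orbit vsval_osp_even_elt // block_mxKul block_mxKdr => -[-> jy].
by exists y.
Qed.

Lemma jordan_type_conj d (y y' : 'M[K]_d) :
  has_jordan_type y mu -> has_jordan_type y' mu ->
  exists2 h, h \in unitmx & h *m y = y' *m h.
Proof.
move=> [P [Q [PQ QP ->]]] [P' [Q' [PQ' QP' ->]]]; exists (P' *m Q).
  have: P' *m Q *m (P *m Q') = 1%:M.
    by rewrite mulmxA -[P' *m Q *m P]mulmxA QP mulmx1.
  by case/mulmx1_unit.
rewrite !mulmxA -[P' *m Q *m P]mulmxA QP mulmx1.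
by rewrite -[_ *m Q' *m P']mulmxA QP' mulmx1.
Qed.

Lemma conj_jordan_type d (y y' h : 'M[K]_d) : h \in unitmx -> h *m y = y' *m h ->
  has_jordan_type y mu -> has_jordan_type y' mu.
Proof.
move=> uh hy [P [Q [PQ QP yE]]]; exists (h *m P), (Q *m invmx h); split.
- by rewrite mulmxA -[h *m P *m Q]mulmxA PQ mulmx1 mulmxV.
- by rewrite mulmxA mulmxKV.
- apply: (can_inj (mulmxK uh)); rewrite -hy yE.
  by rewrite -!mulmxA mulVmx // mulmx1.
Qed.

Variable B : even g -> even g -> K.
Hypothesis Binv : nondegenerate_invariant_form B.

(** A symplectic [s] conjugates [y] to [y']; conjugating [y] by the curve [S] from the identity to a
    multiple of [s] stays in the orbit wherever [d] does not vanish. *)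
Lemma orbit_rationally_connected : (0 < r)%N ->
  rationally_connected
    (fun x (i : 'I_(\dim {: even g})) => B x (vbasis {: even g})`_i)
    (@osp_orbit K m r mu).
Proof.
move=> r0 _ _ /osp_orbitP[y [-> Sy jy]] /osp_orbitP[y' [-> Sy' jy']].
have [h uh hy] := jordan_type_conj jy jy'.
have [s sJ sy] := sp_conj Sy Sy' uh hy.
have [S [d [b [SJ S0 b0 S1]]]] := sp_curve_sp sJ.
(* A nonzero [J] allows multipliers to be compared, which gives [d.[0] = 1] and [d.[1] = b ^+ 2]. *)
have J0 : J != 0.
  apply/eqP => J0; have := mulmxV (symplectic_mx_unit K r); rewrite J0 mul0mx.
  move/matrixP/(_ (lshift r (Ordinal r0)) (lshift r (Ordinal r0)))/eqP.
  by rewrite !mxE eqxx eq_sym oner_eq0.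
pose ev t := map_mx (horner_eval t) : 'M[{poly K}]_n -> 'M[K]_n.
have evC t (M : 'M[K]_n) : ev t M^P = M.
  by apply/matrixP => i j; rewrite !mxE /horner_eval hornerC.
have evJ t : (ev t S)^T *m J *m ev t S = d.[t] *: J.
  have := congr1 (ev t) SJ; rewrite /ev map_mxZ !map_mxM -map_trmx.
  by rewrite -/(ev t J^P) evC.
have d0 : d.[0] = 1.
  have := evJ 0; rewrite /ev S0 trmx1 mul1mx mulmx1 => /esym/eqP.
  rewrite -subr_eq0 -{2}[J]scale1r -scalerBl scaler_eq0 (negPf J0) orbF.
  by rewrite subr_eq0 => /eqP.
have d1 : d.[1] = b ^+ 2.
  have := evJ 1; rewrite /ev S1 [(b *: s)^T]linearZ /= -scalemxAr.
  rewrite -!scalemxAl scalerA sJ => /esym/eqP.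
  rewrite -subr_eq0 -scalerBl scaler_eq0 (negPf J0) orbF.
  by rewrite subr_eq0 => /eqP.
(* From [S^T J S = d J] follows [S^-1 = - d^-1 J S^T J], so [N / d] is [S y S^-1]. *)
pose N := - (S *m y^P *m J^P *m S^T *m J^P).
pose phi t := (d.[t])^-1 *: ev t N.
have phiS t : d.[t] != 0 -> ev t S *m y = phi t *m ev t S.
  move=> dt; rewrite /phi /N /ev map_mxN !map_mxM -map_trmx -!/(ev t _) !evC.
  rewrite -scalemxAl mulNmx -!mulmxA [_^T *m (J *m _)]mulmxA evJ.
  rewrite -!scalemxAr symplectic_mxK !mulmxN !scalerN opprK mulmx1.
  by rewrite scalerA mulVf // scale1r.
have unitS t : d.[t] != 0 -> ev t S \in unitmx.
  move=> dt; have: ((d.[t])^-1 *: (- J *m (ev t S)^T *m J)) *m ev t S = 1%:M.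
    rewrite -scalemxAl -!mulmxA [_^T *m _]mulmxA evJ -scalemxAr scalerA mulVf //.
    by rewrite scale1r mulNmx symplectic_mxK opprK.
  by case/mulmx1_unit.
have phi_sp t : d.[t] != 0 -> is_sp (phi t).
  move=> dt; have uS := unitS _ dt; have uST : (ev t S)^T \in unitmx by rewrite unitmx_tr.
  apply: (can_inj (mulKmx uST)); apply: (can_inj (mulmxK uS)).
  rewrite mulmxN mulNmx !mulmxA -trmx_mul -phiS // -[_ *m J *m phi t *m _]mulmxA -phiS //.
  rewrite trmx_mul -!mulmxA [_^T *m (J *m ev t S)]mulmxA evJ.
  rewrite [_^T *m (J *m (_ *m _))]mulmxA [_^T *m J *m _]mulmxA evJ.
  by rewrite -scalemxAl -scalemxAr Sy scalerN.
have phi_jordan t : d.[t] != 0 -> has_jordan_type (phi t) mu.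
  by move=> dt; apply: conj_jordan_type jy; [exact: unitS dt | exact: phiS].
pose f i (M : 'M[K]_n) := B (osp_even_elt 0 M) (vbasis {: even g})`_i.
have fl i : scalar (f i).
  by move=> k M M'; rewrite /f osp_even_elt_linear; case: Binv => ->.
(* Thanks to the projection in [osp_even_elt], [f i] is linear on all matrices and can be expanded
   over elementary ones, which need not lie in sp(2r). *)
pose v i := \sum_(jk : 'I_n * 'I_n) N jk.1 jk.2 * (f i (delta_mx jk.1 jk.2))%:P.
have vE t i : f i (phi t) = (v i).[t] / d.[t].
  have -> : phi t = \sum_(jk : 'I_n * 'I_n)
      (d.[t]^-1 * (N jk.1 jk.2).[t]) *: delta_mx jk.1 jk.2.
    rewrite [LHS]matrix_sum_delta pair_bigA /=; apply: eq_bigr => jk _.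
    by rewrite !mxE.
  rewrite scalar_sum // horner_sum mulr_suml; apply: eq_bigr => jk _.
  by rewrite !hornerE; ring.
exists v, d; split.
- rewrite d0 oner_neq0; split=> // i; rewrite -d0 -vE /f; congr (B (osp_even_elt 0 _) _).
  have := phiS 0; rewrite d0 oner_neq0 => /(_ isT).
  by rewrite /ev S0 mul1mx mulmx1.
- have d1n : d.[1] != 0 by rewrite d1 expf_neq0.
  split=> // i; rewrite -vE /f; congr (B (osp_even_elt 0 _) _).
  have us : s \in unitmx.
    have := unitS _ d1n; rewrite /ev S1; rewrite unitmxZ // unitfE //.
  have := phiS _ d1n; rewrite /ev S1 -scalemxAl -scalemxAr sy => /(can_inj (scalerK b0)).
  by move/(can_inj (mulmxK us)).
move=> t dt; exists (osp_even_elt 0 (phi t)).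
  by apply/osp_orbitP; exists (phi t); split; [|exact: phi_sp | exact: phi_jordan].
by move=> i; rewrite -vE.
Qed.

Lemma k_orbit_osp : (0 < r)%N -> (exists x, @osp_orbit K m r mu x) ->
  k_orbit_eq B (@osp_orbit K m r mu) (m * \rank (jordan_mx K mu)).
Proof.
move=> r0 ne; have [q qP] := vanishing_ideal_prime ne (orbit_rationally_connected r0).
exists q; split; first exact: qP.
apply: (mxrank_residue qP ne) => _ /osp_orbitP[y [-> Sy jy]].
transitivity (m * \rank y)%N.
  rewrite -(osp_gram_rank two_neq0 Binv r0 Sy); congr (\rank _).
  apply/matrixP => i j; rewrite !mxE; exact: meval_even_to_sym.
congr (_ * _)%N; case: jy => P [Q [PQ QP ->]].
have uP : \rank (jordan_mx K mu) = \rank (Q *m (P *m jordan_mx K mu *m Q) *m P).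
  by rewrite !mulmxA QP mul1mx -mulmxA QP mulmx1.
apply/anti_leq/andP; split.
  exact: leq_trans (mxrankM_maxl _ _) (mxrankM_maxr _ _).
by rewrite {1}uP; apply: leq_trans (mxrankM_maxl _ _) (mxrankM_maxr _ _).
Qed.

End OrbitCurve.

(** * Skew forms compatible with Jordan matrices *)

Section JordanForm.
Variable K : fieldType.

Lemma signr_eq_odd i j : odd i = odd j -> (-1) ^+ i = (-1) ^+ j :> K.
Proof. by move=> ij; rewrite -signr_odd ij signr_odd. Qed.

Lemma rev_ord_eq p (i j : 'I_p) : (j == rev_ord i) = (i == rev_ord j).
Proof. by rewrite -(can_eq rev_ordK) rev_ordK eq_sym. Qed.

(** Up to scaling, the invariant form of the irreducible sl2-module of dimension [p]: symmetric for
    odd [p], skew for even [p]. *)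
Definition alt_antidiag p : 'M[K]_p :=
  \matrix_(i, j) ((-1) ^+ i * (j == rev_ord i)%:R).

Lemma alt_antidiag_tr p : (alt_antidiag p)^T = (-1) ^+ p.-1 *: alt_antidiag p.
Proof.
apply/matrixP => i j; rewrite !mxE rev_ord_eq.
case: eqP => [->|_]; last by rewrite !mulr0.
rewrite !mulr1 -exprD; apply: signr_eq_odd.
by rewrite /=; have := ltn_ord i; lia.
Qed.

Lemma alt_antidiag_sqr p :
  alt_antidiag p *m alt_antidiag p = (-1) ^+ p.-1 *: 1%:M.
Proof.
apply/matrixP => i j; rewrite !mxE (bigD1 (rev_ord i)) //= big1 ?addr0; last first.
  by move=> k /negPf ki; rewrite !mxE ki mulr0 mul0r.
rewrite !mxE eqxx mulr1 rev_ordK mulrA -exprD eq_sym.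
congr (_ * _); apply: signr_eq_odd; rewrite /=; have := ltn_ord i; lia.
Qed.

Lemma alt_antidiag_nilpotent p :
  (nilpotent_block K p)^T *m alt_antidiag p = - (alt_antidiag p *m nilpotent_block K p).
Proof.
apply/matrixP => i j; rewrite !mxE.
have -> : \sum_k alt_antidiag p i k * nilpotent_block K p k j =
    (-1) ^+ i * (i + j == p)%N%:R.
  rewrite (bigD1 (rev_ord i)) //= big1 ?addr0; last first.
    by move=> k /negPf ki; rewrite !mxE ki mulr0 mul0r.
  rewrite !mxE eqxx mulr1; congr (_ * _%:R); rewrite /=; have := ltn_ord i; lia.
rewrite (bigD1 (rev_ord j)) //= big1 ?addr0; last first.
  move=> k /negPf kj; by rewrite !mxE rev_ord_eq kj !mulr0.
rewrite !mxE rev_ordK eqxx mulr1 mulrC.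
have -> : (i == (rev_ord j).+1 :> nat) = (i + j == p)%N.
  by rewrite /=; have := ltn_ord j; lia.
case: eqP => [ij|_]; last by rewrite !mulr0 oppr0.
rewrite !mulr1 -[RHS]mulN1r -[RHS]exprS; apply: signr_eq_odd.
by rewrite /=; have := ltn_ord j; lia.
Qed.

Definition has_skew_form d (N : 'M[K]_d) : Prop :=
  exists w : 'M_d, [/\ w^T = - w, w \in unitmx & N^T *m w = - (w *m N)].

Lemma has_skew_form_cast d d' (e : d = d') (N : 'M[K]_d) :
  has_skew_form N -> has_skew_form (castmx (e, e) N).
Proof. by case: _ / e; rewrite castmx_id. Qed.

Lemma has_skew_form_even p d (N : 'M[K]_d) : ~~ odd p ->
  has_skew_form N -> has_skew_form (block_mx (nilpotent_block K p) 0 0 N).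
Proof.
move=> ev [w [wT uw Nw]].
have sg (X : 'M[K]_p) : (-1) ^+ p.-1 *: X = - X.
  (* For [p = 0] the truncated [p.-1] gives the sign [1], but the block is empty. *)
  case: p ev X => [|p] ev X; first by rewrite [LHS]flatmx0 [RHS]flatmx0.
  rewrite -scaleN1r -[X in _ = X *: _]expr1 (@signr_eq_odd _ 1) //.
  by move: ev; rewrite /= negbK.
exists (block_mx (alt_antidiag p) 0 0 w); split.
- by rewrite tr_block_mx !trmx0 wT alt_antidiag_tr sg opp_block_mx !oppr0.
- have : block_mx (alt_antidiag p) 0 0 w *m
      block_mx (- alt_antidiag p) 0 0 (invmx w) = 1%:M.
    rewrite mulmx_block !(mul0mx, mulmx0, addr0, add0r) mulmxV // mulmxN.
    by rewrite alt_antidiag_sqr sg opprK -scalar_mx_block.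
  by case/mulmx1_unit.
rewrite tr_block_mx !trmx0 !mulmx_block !(mul0mx, mulmx0, addr0, add0r).
by rewrite alt_antidiag_nilpotent Nw opp_block_mx !oppr0.
Qed.

(** For odd [p] the antidiagonal form is symmetric, so two equal blocks are paired off-diagonally
    with opposite signs to make a skew form. *)
Lemma has_skew_form_odd p d (N : 'M[K]_d) : odd p -> has_skew_form N ->
  has_skew_form (block_mx (nilpotent_block K p) 0 0
                   (block_mx (nilpotent_block K p) 0 0 N)).
Proof.
move=> op [w [wT uw Nw]]; set A := alt_antidiag p.
have sg : (-1) ^+ p.-1 = 1 :> K.
  by rewrite -signr_odd (_ : odd p.-1 = false) //; lia.
have AT : A^T = A by rewrite alt_antidiag_tr sg scale1r.
have AA : A *m A = 1%:M by rewrite alt_antidiag_sqr sg scale1r.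
exists (block_mx 0 (row_mx A 0) (col_mx (- A) 0) (block_mx 0 0 0 w)); split.
- rewrite tr_block_mx tr_col_mx tr_row_mx tr_block_mx !trmx0 wT linearN /= AT.
  by rewrite !opp_block_mx opp_row_mx opp_col_mx !oppr0 opprK.
- have : block_mx 0 (row_mx A 0) (col_mx (- A) 0) (block_mx 0 0 0 w) *m
      block_mx 0 (row_mx (- A) 0) (col_mx A 0) (block_mx 0 0 0 (invmx w)) = 1%:M.
    rewrite mulmx_block mul_row_col mul_row_block mul_block_col mul_col_row mulmx_block.
    rewrite !(mul0mx, mulmx0, addr0, add0r) mulmxV // mulmxN mulNmx opprK AA.
    rewrite row_mx0 col_mx0 add_block_mx !addr0 add0r.
    by rewrite -!scalar_mx_block.
  by case/mulmx1_unit.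
rewrite !tr_block_mx !trmx0 !mulmx_block.
rewrite !mul_row_block !mul_block_col !mul_mx_row !mul_col_mx ?mulmx_block.
rewrite !(mul0mx, mulmx0, addr0, add0r) alt_antidiag_nilpotent Nw.
rewrite !col_mx0 !row_mx0 !(addr0, add0r) mulmxN mulNmx alt_antidiag_nilpotent.
by rewrite !opp_block_mx opp_row_mx opp_col_mx !oppr0.
Qed.

Lemma jordan_mx_cons p mu : jordan_mx K (p :: mu) =
  castmx (mxsize_recl, mxsize_recl)
    (block_mx (nilpotent_block K p) 0 0 (jordan_mx K mu)).
Proof. by rewrite /jordan_mx mxdiag_recl. Qed.

(** Even parts are peeled off singly and odd parts in equal pairs, which is why the induction is on
    a bound for the size. *)
Lemma jordan_skew_form mu : sorted geq mu ->
  (forall p, odd p -> ~~ odd (count_mem p mu)) -> has_skew_form (jordan_mx K mu).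
Proof.
elim: {mu}(size mu).+1 {-2}mu (ltnSn (size mu)) => // k IHk [|p mu] /= sz srt cnt.
  rewrite /jordan_mx; move: (mxdiag _); rewrite big_ord0 => N.
  by exists 1%:M; split; rewrite ?unitmx1 //; apply/matrixP => -[].
have [op|ep] := boolP (odd p); last first.
  rewrite jordan_mx_cons; apply/has_skew_form_cast/has_skew_form_even => //.
  apply: IHk => [//||q oq]; first exact: path_sorted srt.
  by have := cnt q oq; case: eqP => // pq; rewrite pq oq in ep.
case: mu sz srt cnt => [|q mu] /= sz; first by move=> _ /(_ p op); rewrite eqxx.
move=> /andP[qp srt] cnt.
(* If [q] differed from [p], even multiplicity would force another [p] further on, and sortedness
   would give [p <= q <= p]. *)
have pq : p = q.
  apply/eqP; rewrite eqn_leq qp andbT.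
  have := cnt p op; rewrite eqxx /=; case: eqP => [-> //|qnp].
  rewrite add0n; case: (boolP (p \in mu)) => [pmu _|]; last first.
    by rewrite -has_pred1 has_count -leqNgt leqn0 => /eqP ->.
  have tr : transitive geq by move=> a b c ab bc; apply: leq_trans bc ab.
  exact: (allP (order_path_min tr srt)).
rewrite -{}pq in srt cnt *; rewrite !jordan_mx_cons.
have -> : forall d d' (e : d' = d) (M : 'M[K]_d'),
    block_mx (nilpotent_block K p) 0 0 (castmx (e, e) M) =
    castmx (congr1 (addn p) e, congr1 (addn p) e)
      (block_mx (nilpotent_block K p) 0 0 M).
  by move=> d d' e M; case: _ / e; rewrite !castmx_id.
do 2!apply: has_skew_form_cast; apply: has_skew_form_odd => //; apply: IHk.
- by move: sz => /=; lia.
- exact: path_sorted srt.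
by move=> s os; have := cnt s os; rewrite addnA oddD; case: eqP.
Qed.
End JordanForm.

(** * Points of the orbits and conclusion *)

(** An empty orbit would have the unit ideal as vanishing ideal, which is not prime. If [s^T J s] is
    a skew form [w] compatible with the Jordan matrix [N], then [s N s^-1] lies in sp(2r). *)
Lemma osp_orbit_nonempty (K : numClosedFieldType) m r mu :
  is_partition mu (2 * r) ->
  (forall p, odd p -> ~~ odd (count_mem p mu)) ->
  exists x, @osp_orbit K m r mu x.
Proof.
case=> srt _ szmu cnt; have [w [wT uw Nw]] := jordan_skew_form K srt cnt.
suff [y Sy jy] : exists2 y : 'M[K]_(r + r), is_sp y & has_jordan_type y mu.
  by exists (osp_even_elt 0 y); apply/osp_orbitP; exists y.
have: (\sum_(i < size mu) nth 0%N mu i = r + r)%N.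
  by rewrite addnn -mul2n -szmu sumnE (big_nth 0%N) big_mkord.
(* The Jordan matrix and its size are generalised so that the size can be replaced by [r + r]. *)
rewrite /has_jordan_type; move: (jordan_mx K mu) w wT uw Nw.
move: (\sum_(i < _) _)%N => d N w wT uw Nw e; subst d.
have [s us sw] := skew_mx_congruent wT uw.
exists (s *m N *m invmx s); last first.
  by exists s, (invmx s); rewrite mulmxV // mulVmx.
have ust : s^T \in unitmx by rewrite unitmx_tr.
apply: (can_inj (mulKmx ust)); apply: (can_inj (mulmxK us)).
transitivity (N^T *m (s^T *m symplectic_mx K r *m s)).
  by rewrite !trmx_mul trmx_inv !mulmxA mulmxV // mul1mx.
by rewrite sw Nw -sw mulmxN mulNmx !mulmxA mulmxKV.
Qed.

Theorem theorem3p6 (R : realType) (r : nat) (mu : seq nat)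
    (hr : (1 <= r)%N)
    (hmu : is_partition mu (2 * r))
    (hodd : forall p : nat, odd p -> ~~ odd (count_mem p mu)) :
  (forall B : even (osp R[i] 1 r) -> even (osp R[i] 1 r) -> R[i],
      nondegenerate_invariant_form B ->
      k_orbit_eq B (@osp_orbit R[i] 1 r mu) (\rank (jordan_mx R[i] mu)))
  /\
  (forall B : even (osp R[i] 2 r) -> even (osp R[i] 2 r) -> R[i],
      nondegenerate_invariant_form B ->
      k_orbit_eq B (@osp_orbit R[i] 2 r mu) (2 * \rank (jordan_mx R[i] mu))).
Proof.
split=> B Binv; last first.
  by apply: k_orbit_osp => //; apply: osp_orbit_nonempty.
rewrite -[\rank _]mul1n.
by apply: k_orbit_osp => //; apply: osp_orbit_nonempty.
Qed.
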